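(* Almost surely, as $\lambda\to+\infty$, $$(\lambda^2d_\lambda(t))_{t\in(0,2\pi)}\longrightarrow(X_t)_{t\in(0,2\pi)}\quad\text{in }L^1(0,2\pi),$$ where for every $i\in\{1,\ldots,N_e\}$ and $t\in[\theta_i,\theta_{i+1})$, $$X_t=-\frac{\Upsilon_i^2}{2R_i}\,\frac{\cos\bigl(2(\Theta_i-t)\bigr)}{\cos^3(\Theta_i-t)}.$$
   Context: Let $\mu$ be a probability measure on $\mathbb{R}_+$ with $\int R\,\mathrm{d}\mu(R)=1$, $\int R^2\,\mathrm{d}\mu(R)<+\infty$ and $\mu((R_\star,+\infty))=1$ for some $R_\star>0$. Let $\mathbf{Z}$ be a Poisson point process on $\mathbb{R}_+\times[0,2\pi)\times\mathbb{R}_+$ with intensity measure $\mathrm{d}\rho\,\mathrm{d}\theta\,\mathrm{d}\mu(R)$; everything below is built from this single process, simultaneously for all $\lambda>0$. Line process and Crofton cell: to each $(\rho,\theta,R)\in\mathbf{Z}$ associate the line $D_{\rho,\theta}=\{x\in\mathbb{R}^2:\ x_1\cos\theta+x_2\sin\theta=\rho\}$. The Crofton cell $\mathcal{C}$ is the closed (almost surely bounded) convex polygon containing $0$ which is the closure of the connected component containing $0$ of the complement of the union of these lines. It has $N_e$ vertices, listed anti-clockwise as $V_1,\ldots,V_{N_e}$, with polar angles $0\le\theta_1<\cdots<\theta_{N_e}<2\pi$. Edge $i$ joins $V_i$ (included) to $V_{i+1}$ (excluded), indices being cyclic; $(\Upsilon_i,\Theta_i,R_i)\in\mathbf{Z}$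 is the marked point whose line supports edge $i$ (distance to the origin, polar angle, associated radius). The interval $[\theta_{N_e},\theta_1)$ is understood cyclically modulo $2\pi$. Coupled disc model: let $\psi_\lambda(\rho,R)=R\sqrt{1+2\rho/(\lambda^2R)}$. To each $(\rho,\theta,R)\in\mathbf{Z}$ associate the open disc of radius $R$ whose centre has polar coordinates $(\psi_\lambda(\rho,R),\theta)$, and let $\mathcal{O}_\lambda$ be the union of these discs (it does not contain $0$). Let $D_0^\lambda$ be the connected component of $\mathbb{R}^2\setminus\mathcal{O}_\lambda$ containing $0$, and let $D^\lambda=\lambda^2D_0^\lambda$ if this set is bounded, $D^\lambda=K_0$ (a given fixed compact set) otherwise. For $t\in[0,2\pi)$ let $\Delta_t$ be the open half-line from $0$ in direction $t$. The defect at angle $t$ is $$d_\lambda(t)=\operatorname{dist}(0,\Delta_t\cap\partial D^\lambda)-\operatorname{dist}(0,\Delta_t\cap\partial\mathcal{C}),$$ with $\operatorname{dist}$ the Euclidean distance. *)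

(* Defs.v *)
From HB Require Import structures.
From mathcomp Require Import all_boot all_order all_algebra.
From mathcomp Require Import all_classical all_reals all_analysis.
From mathcomp Require Import measurable_realfun.

Set Implicit Arguments.
Unset Strict Implicit.
Unset Printing Implicit Defensive.

Import Order.TTheory GRing.Theory Num.Theory.
Import numFieldNormedType.Exports.

Local Open Scope classical_set_scope.
Local Open Scope ring_scope.

Section PointProcess.
Context d (Omega : measurableType d) d' (T : measurableType d') (R : realType).

(* A process without multiple points, given by its random set of points; a
   Poisson process whose intensity has no atom is of this kind. *)
Definition point_count (Z : Omega -> set T) (A : set T) (w : Omega) : \bar R :=
  counting (Z w `&` A).

(* [poisson_prob] does not depend on its second argument, and [poisson_prob 0 _]
   is the Dirac mass at 0. In the independence clause, the events
   [N(A_i) = k_i] suffice because the counts take values in the countable set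
   {0, 1, ..., +oo}. *)
Record poisson_point_process (P : probability Omega R) (m : set T -> \bar R)
    (Z : Omega -> set T) : Prop := PoissonPointProcess {
  ppp_measurable : forall A, measurable A ->
    measurable_fun setT (point_count Z A);
  ppp_law_fin : forall A (k : nat), measurable A -> (m A < +oo)%E ->
    P [set w | point_count Z A w = k%:R%:E] =
    poisson_prob (fine (m A)) 0 [set k];
  ppp_law_infty : forall A, measurable A -> m A = +oo%E ->
    P [set w | point_count Z A w = +oo%E] = 1%E;
  ppp_independence : forall n (A : 'I_n -> set T) (k : 'I_n -> \bar R),
    (forall i, measurable (A i)) -> trivIset setT A ->
    P [set w | forall i, point_count Z (A i) w = k i] =
    (\prod_(i < n) P [set w | point_count Z (A i) w = k i])%E
}.

End PointProcess.

Section Plane.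
Context {R : realType}.
Implicit Types (x : R * R) (A : set (R * R)) (t : R).

(* The library's norm on [R * R] is the sup norm; it defines the same topology
   and the same bounded sets as the Euclidean norm. *)
Definition enorm x : R := Num.sqrt (x.1 ^+ 2 + x.2 ^+ 2).

Definition dir t : R * R := (cos t, sin t).

Definition boundary A : set (R * R) := closure A `\` interior A.

Definition half_line t : set (R * R) := [set r *: dir t | r in `]0, +oo[].

(* dist(0, A), for nonempty [A]; the value is 0 when [A] is empty. *)
Definition dist0 A : R := inf (enorm @` A).

Definition extreme_points A : set (R * R) :=
  [set x | A x /\ forall y z (s : R), A y -> A z -> 0 < s < 1 ->
     x = (1 - s) *: y + s *: z -> y = z].

End Plane.

Section Model.
Context {R : realType}.

(* ((rho, theta), r) : [rho], [theta] position of a line, [r] radius;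
   [measurableTypeR R] is [R] with its Borel sets *)
Definition mark : Type :=
  (measurableTypeR R * measurableTypeR R * measurableTypeR R)%type.
Implicit Types (z : mark) (lam t : R).

Definition mark_space : set mark :=
  `[0, +oo[ `*` `[0, 2 * pi[ `*` `[0, +oo[.

(* d rho d theta d mu(r) on [mark_space] *)
Definition intensity (mu : probability (measurableTypeR R) R)
    (A : set (measurableTypeR R * measurableTypeR R * measurableTypeR R)) :
    \bar R :=
  ((lebesgue_measure \x lebesgue_measure) \x mu)%E (A `&` mark_space).

Definition line z : set (R * R) :=
  let: (rho, theta, _) := (z : R * R * R) in
  [set x | x.1 * cos theta + x.2 * sin theta = rho].

Definition crofton_cell Z : set (R * R) :=
  closure (connected_component (~` \bigcup_(z in Z) line z) 0).

Definition psi lam (rho r : R) : R :=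
  r * Num.sqrt (1 + 2 * rho / (lam ^+ 2 * r)).

Definition disc lam z : set (R * R) :=
  let: (rho, theta, r) := (z : R * R * R) in
  [set x | enorm (x - psi lam rho r *: dir theta) < r].

Definition D0_ lam Z : set (R * R) :=
  connected_component (~` \bigcup_(z in Z) disc lam z) 0.

Definition D_ (K0 : set (R * R)) lam Z : set (R * R) :=
  if `[< bounded_set (D0_ lam Z) >] then [set lam ^+ 2 *: x | x in D0_ lam Z]
  else K0.

Definition defect (K0 : set (R * R)) Z lam t : R :=
  dist0 (half_line t `&` boundary (D_ K0 lam Z)) -
  dist0 (half_line t `&` boundary (crofton_cell Z)).

(* V_i (included) to V_{i+1} (excluded), cyclically *)
Definition edge n (V : 'I_n -> R * R) (i : 'I_n) : set (R * R) :=
  [set (1 - s) *: V i + s *: V (ordS i) | s in `[0, 1[].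

(* [V] lists anti-clockwise the vertices of the Crofton cell, [th] lists their
   polar angles, and [e i] is the point of [Z] whose line supports edge [i]. *)
Record crofton_polygon Z n (V : 'I_n -> R * R) (th : 'I_n -> R)
    (e : 'I_n -> mark) : Prop := CroftonPolygon {
  crofton_vertices : range V = extreme_points (crofton_cell Z);
  crofton_vertex_neq0 : forall i, V i <> 0;
  crofton_polar : forall i, V i = enorm (V i) *: dir (th i);
  crofton_angle : forall i, 0 <= th i < 2 * pi;
  crofton_order : forall i j : 'I_n, (i < j)%N -> th i < th j;
  crofton_mark : forall i, Z (e i);
  crofton_support : forall i, edge V i `<=` line (e i)
}.

(* [th i, th (i+1)[ modulo 2 pi, among t in [0, 2 pi[; the second case is the
   one of the last index [i]. *)
Definition angular_arc n (th : 'I_n -> R) (i : 'I_n) : set R :=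
  [set t : R | 0 <= t < 2 * pi /\
     if th i < th (ordS i) then th i <= t < th (ordS i)
     else (th i <= t) || (t < th (ordS i))].

Definition limit_defect z t : R :=
  let: (rho, theta, r) := (z : R * R * R) in
  - (rho ^+ 2 / (2 * r)) * (cos (2 * (theta - t)) / cos (theta - t) ^+ 3).

End Model.
Arguments mark : clear implicits.

(* F_l --> G in L^1(D) as l --> +oo *)
Definition cvg_L1 (R : realType) (D : set R) (F : R -> R -> R) (G : R -> R) :=
  [/\ (@lebesgue_measure R).-integrable D (EFin \o G),
      \forall l \near +oo, (@lebesgue_measure R).-integrable D (EFin \o F l) &
      (\int[@lebesgue_measure R]_(t in D) `|F l t - G t|%:E)%E
        @[l --> +oo] --> 0%E].

(* Main.v *)
Require Import Defs.
From HB Require Import structures.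
From mathcomp Require Import all_boot all_order all_algebra.
From mathcomp Require Import all_classical all_reals all_analysis.
From mathcomp Require Import measurable_realfun.
From mathcomp Require Import ring lra.
From mathcomp Require finmap.

Set Implicit Arguments.
Unset Strict Implicit.
Unset Printing Implicit Defensive.

Import Order.TTheory GRing.Theory Num.Theory.
Import numFieldNormedType.Exports.

Local Open Scope classical_set_scope.
Local Open Scope ring_scope.

(** Rescale the discs by [lam ^+ 2] and put [eps = lam ^- 2]. A point [x] belongs
    to the rescaled disc of the mark [(rho, theta, r)] when
      [gap = 2 rho r - 2 sqrt (r ^+ 2 + 2 rho r eps) (x . dir theta)
             + eps |x| ^+ 2]
    is negative, and at [eps = 0] this is the half-plane cut off by the line of
    the mark. The disc cell is thus a perturbation of the Crofton cell depending
    on [eps], and the limit defect is the derivative in [eps] of its radial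
    function.

    The geometric part concerns one fixed configuration. Four lines, one across
    each quadrant, confine the Crofton cell to a disc of radius [G]. Inside the
    disc of radius [2 G], only the finitely many marks with [rho] below some bound
    have any effect, uniformly for small [eps] ([far_gap_gt0]), and each point of
    the circle of radius [2 G] is covered by a disc ([circle_covered]). Hence the
    component of 0 cannot leave this circle, and it is the star-shaped set where
    all gaps are nonnegative ([D0_E], [star_cell]); a ray from 0 crosses the
    boundary of such a set exactly once ([dist0_boundary]). The defect is
    therefore the difference of two radial functions ([defectE]). It is bounded by
    a multiple of [eps], uniformly in the direction ([radial_lipschitz]). In a
    direction that meets the Crofton cell inside an edge, the mark of this edge
    is the only tight one for small [eps] too, so the radial function solves
    [gap = 0] for this single mark, and comparing this equation with the one at
    [eps = 0] yields the pointwise limit ([defect_cvg]). The excluded directions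
    are those of the finitely many vertices, and dominated convergence gives the
    convergence in mean ([config_cvg_L1]).

    The vertices of the Crofton cell are the boundary points where two half-planes
    are tight ([extreme_points_vertices]). Between two consecutive vertex angles
    the tight mark cannot change, by connectedness ([one_active_between]), which
    attaches a mark to each edge ([crofton_polygon_exists]).

    The probabilistic part shows that almost every configuration has the
    properties used above ([ae_generic_config]): it is locally finite, all radii
    exceed [Rstar], all distances are positive, each open quadrant contains a
    normal direction, and no two marks have the same angle. *)

(** * Polar coordinates in the plane *)

Section PlaneGeometry.
Context {R : realType}.
Implicit Types (x y : R * R) (s t : R).

Lemma scale_fst s x : (s *: x).1 = s * x.1. Proof. by []. Qed.
Lemma scale_snd s x : (s *: x).2 = s * x.2. Proof. by []. Qed.
Lemma add_fst x y : (x + y).1 = x.1 + y.1. Proof. by []. Qed.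
Lemma add_snd x y : (x + y).2 = x.2 + y.2. Proof. by []. Qed.

Lemma opp_fst x : (- x).1 = - x.1. Proof. by []. Qed.
Lemma opp_snd x : (- x).2 = - x.2. Proof. by []. Qed.

Lemma pair_ext x y : x.1 = y.1 -> x.2 = y.2 -> x = y.
Proof. by case: x y => [a b] [c e] /= -> ->. Qed.

Definition coordE := (scale_fst, scale_snd, add_fst, add_snd, opp_fst, opp_snd).

Lemma sqr_enorm x : enorm x ^+ 2 = x.1 ^+ 2 + x.2 ^+ 2.
Proof. by rewrite sqr_sqrtr// addr_ge0// sqr_ge0. Qed.

Lemma enorm_ge0 x : 0 <= enorm x. Proof. exact: sqrtr_ge0. Qed.

Lemma enorm_dir t : enorm (dir t) = 1.
Proof. by rewrite /enorm /= cos2Dsin2 sqrtr1. Qed.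

Lemma enormZ s x : enorm (s *: x) = `|s| * enorm x.
Proof.
rewrite /enorm !coordE !exprMn -mulrDr sqrtrM ?sqr_ge0//.
by rewrite sqrtr_sqr.
Qed.

Lemma enorm_polar s t : 0 <= s -> enorm (s *: dir t) = s.
Proof. by move=> s0; rewrite enormZ enorm_dir mulr1 ger0_norm. Qed.

Lemma enorm_eq0 x : enorm x = 0 -> x = 0.
Proof.
move=> x0; have := sqr_enorm x; rewrite x0 expr0n/= => /esym/eqP.
rewrite paddr_eq0 ?sqr_ge0// !sqrf_eq0 => /andP[/eqP x1 /eqP x2].
by case: x x1 x2 {x0} => a b /= -> ->.
Qed.

Lemma enorm0 : enorm 0 = 0 :> R.
Proof. by rewrite -(scale0r (dir 0)) enorm_polar. Qed.

Lemma coord1_enorm x : `|x.1| <= enorm x.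
Proof.
by rewrite -sqrtr_sqr ler_sqrt ?addr_ge0 ?sqr_ge0// lerDl sqr_ge0.
Qed.

Lemma coord2_enorm x : `|x.2| <= enorm x.
Proof.
by rewrite -sqrtr_sqr ler_sqrt ?addr_ge0 ?sqr_ge0// lerDr sqr_ge0.
Qed.

Lemma continuous_fst : continuous (fun x : R * R => x.1).
Proof. by move=> x; exact: cvg_fst. Qed.
Lemma continuous_snd : continuous (fun x : R * R => x.2).
Proof. by move=> x; exact: cvg_snd. Qed.

Lemma continuous_enorm : continuous (@enorm R).
Proof.
move=> x; rewrite /enorm.
apply: (@continuous_comp _ _ _ (fun x : R * R => x.1 ^+ 2 + x.2 ^+ 2)).
  apply: cvgD.
    apply: (@continuous_comp _ _ _ (fun x : R * R => x.1) (fun u => u ^+ 2)).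
      exact: continuous_fst.
    exact: exprn_continuous.
  apply: (@continuous_comp _ _ _ (fun x : R * R => x.2) (fun u => u ^+ 2)).
    exact: continuous_snd.
  exact: exprn_continuous.
exact: sqrt_continuous.
Qed.

Lemma continuous_dir : continuous (@dir R).
Proof.
move=> t; rewrite /dir; apply: (@cvg_pair _ _ _ (nbhs t) (nbhs (cos t))
  (nbhs (sin t)) _ _ _ (@cos R) (@sin R)).
  exact: continuous_cos.
exact: continuous_sin.
Qed.

Lemma polarP x : exists t, 0 <= t < 2 * pi /\ x = enorm x *: dir t.
Proof.
have pi0 := @pi_gt0 R.
have [x0|nx0] := eqVneq (enorm x) 0.
  exists 0; split; first by lra.
  by rewrite x0 scale0r (enorm_eq0 x0).
have n0 : 0 < enorm x by rewrite lt_neqAle eq_sym nx0 enorm_ge0.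
pose a := x.1 / enorm x; pose b := x.2 / enorm x.
have xa : x.1 = enorm x * a by rewrite /a mulrC divfK.
have xb : x.2 = enorm x * b by rewrite /b mulrC divfK.
have ab : a ^+ 2 + b ^+ 2 = 1.
  rewrite /a /b !exprMn -mulrDl -sqr_enorm -exprMn mulfV// expr1n//.
have a1 : -1 <= a <= 1.
  by rewrite -ler_norml -(@expr_le1 _ 2)// ?real_normK ?num_real// -ab lerDl sqr_ge0.
have sa : sin (acos a) = `|b|.
  by rewrite sin_acos// -ab addrAC subrr add0r sqrtr_sqr.
have ca : cos (acos a) = a by rewrite acosK// in_itv.
have [b0|b0] := leP 0 b.
  exists (acos a); have := acos_ge0 a1; have := acos_lepi a1 => h1 h2.
  split; first by lra.
  rewrite /dir ca sa ger0_norm//.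
  by apply: pair_ext; [exact: xa|exact: xb].
have a_lt1 : a < 1.
  have b2 : 0 < b ^+ 2 by rewrite exprn_even_gt0//= lt_eqF.
  rewrite lt_neqAle; case/andP: a1 => _ ->; rewrite andbT.
  by apply/eqP => a_eq1; move: ab; rewrite a_eq1; lra.
exists (2 * pi - acos a); have := acos_lepi a1.
have /acos_gt0 : -1 <= a < 1 by rewrite a_lt1 (andP a1).1.
move=> h1 h2; split; first by lra.
have -> : dir (2 * pi - acos a) = (a, b).
  rewrite /dir mulr_natl addrC cosD2pi sinD2pi cosN sinN ca sa.
  by rewrite ltr0_norm// opprK.
by apply: pair_ext; [exact: xa|exact: xb].
Qed.

Lemma cos_eq1 t : 0 <= t < 2 * pi -> cos t = 1 -> t = 0.
Proof.
have pi0 := @pi_gt0 R.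
move=> /andP[t0 t2] ct; have [tpi|tpi] := leP t pi.
  by apply: cos_inj; rewrite ?in_itv/= ?t0 ?lexx ?pi_ge0// cos0.
have : 2 * pi - t = 0.
  apply: cos_inj; rewrite ?in_itv/= ?lexx ?pi_ge0//; first by lra.
  by rewrite mulr_natl addrC cosD2pi cosN ct cos0.
by lra.
Qed.

Lemma dir_inj t t' : 0 <= t < 2 * pi -> 0 <= t' < 2 * pi ->
  dir t = dir t' -> t = t'.
Proof.
wlog tt' : t t' / t' <= t.
  by move=> H; have [/H//|/ltW/H H' ? ? ?] := leP t' t; symmetry; apply: H'.
move=> t1 t2 [ct st]; apply/eqP; rewrite -subr_eq0; apply/eqP.
apply: cos_eq1; first by lra.
by rewrite cosB ct st -!expr2 cos2Dsin2.
Qed.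

Lemma dirD2pi t : dir (t + 2 * pi) = dir t :> R * R.
Proof. by rewrite /dir mulr_natl cosD2pi sinD2pi. Qed.

(** The coordinate of [x] along [dir th]; the line of a mark [(rho, th, r)] is
    the set where it equals [rho]. *)
Definition proj (th : R) x : R := x.1 * cos th + x.2 * sin th.

Lemma proj_polar th s t : proj th (s *: dir t) = s * cos (th - t).
Proof. by rewrite /proj !coordE/= cosB; ring. Qed.

Lemma projZ th s x : proj th (s *: x) = s * proj th x.
Proof. by rewrite /proj !coordE; ring. Qed.

Lemma projD th x y : proj th (x + y) = proj th x + proj th y.
Proof. by rewrite /proj !coordE; ring. Qed.

Lemma projB th x y : proj th (x - y) = proj th x - proj th y.
Proof. by rewrite projD -scaleN1r projZ mulN1r. Qed.

Lemma proj_le th x : `|proj th x| <= enorm x.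
Proof.
have [t [_ ->]] := polarP x; rewrite proj_polar (enorm_polar _ (enorm_ge0 x)).
by rewrite normrM (ger0_norm (enorm_ge0 x)) ler_piMr ?enorm_ge0 ?cos_max.
Qed.

Lemma continuous_proj th : continuous (proj th).
Proof.
move=> x; apply: cvgD.
  by apply: cvgM; [exact: continuous_fst|exact: cvg_cst].
by apply: cvgM; [exact: continuous_snd|exact: cvg_cst].
Qed.

End PlaneGeometry.

(** * Star-shaped bodies and their radial functions *)

Section StarBodies.
Context {R : realType}.
Implicit Types (A : set (R * R)) (x y : R * R) (s t : R).

(** The last field says that no segment of the boundary is radial, so that
    each ray from 0 crosses the boundary once. Convex polygons around 0 and the
    disc cells at large scale both have this property, although the latter are
    not convex. *)
Record star_body A : Prop := StarBody {
  star_closed : closed A;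
  star_bounded : exists M, forall y, A y -> enorm y <= M;
  star_0 : A 0;
  star_interior : forall y s, A y -> 0 <= s < 1 -> interior A (s *: y)
}.

Definition radial A t : R := sup [set s | 0 <= s /\ A (s *: dir t)].

Lemma near_ray A x s : interior A (s *: x) ->
  exists2 e : R, 0 < e & forall s', `|s - s'| < e -> A (s' *: x).
Proof.
move=> Asx.
have /nbhs_ballP[e /= e0 He] : \forall s' \near s, A (s' *: x).
  have c : (s' *: x) @[s' --> s] --> s *: x by exact: scalel_continuous.
  exact: c Asx.
by exists e => // s' /He.
Qed.

Variable A : set (R * R).
Hypothesis SA : star_body A.

Lemma star_sub y s : A y -> 0 <= s <= 1 -> A (s *: y).
Proof.
move=> Ay /andP[s0]; rewrite le_eqVlt => /predU1P[->|s1]; first by rewrite scale1r.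
by apply: interior_subset; apply: star_interior => //; rewrite s0 s1.
Qed.

Lemma has_sup_radial t : has_sup [set s | 0 <= s /\ A (s *: dir t)].
Proof.
split; first by exists 0; split => //; rewrite scale0r; exact: star_0.
have [M HM] := star_bounded SA; exists M => s /= [s0 /HM].
by rewrite enorm_polar.
Qed.

Lemma radial_ge0 t : 0 <= radial A t.
Proof.
apply: ub_le_sup; first exact: (has_sup_radial t).2.
by split => //; rewrite scale0r; exact: star_0.
Qed.

Lemma radial_mem t : A (radial A t *: dir t).
Proof.
apply: (star_closed SA) => B.
have c : (s' *: dir t) @[s' --> radial A t] --> radial A t *: dir t.
  exact: scalel_continuous.
move=> /c /nbhs_ballP[e /= e0 He].
have [s /= [s0 As] ses] := sup_adherent e0 (has_sup_radial t).
exists (s *: dir t); split => //; apply: He; rewrite /ball/=.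
have sr : s <= radial A t by apply: ub_le_sup => //; exact: (has_sup_radial t).2.
by rewrite ger0_norm ?subr_ge0// ltrBlDr -ltrBlDl.
Qed.

Lemma radialP t s : 0 <= s -> A (s *: dir t) <-> s <= radial A t.
Proof.
move=> s0; split => [As|sr].
  by apply: ub_le_sup => //; exact: (has_sup_radial t).2.
have [r0|r0] := leP (radial A t) 0.
  by have -> : s = 0 by [lra]; rewrite scale0r; exact: star_0.
have -> : s *: dir t = (s / radial A t) *: (radial A t *: dir t).
  by rewrite scalerA divfK ?gt_eqF.
apply: star_sub; first exact: radial_mem.
by rewrite divr_ge0 ?(ltW r0)//= ler_pdivrMr// mul1r.
Qed.

Lemma radial_gt0 t : 0 < radial A t.
Proof.
have : interior A (0 *: dir t).
  rewrite scale0r -(scale0r 0); apply: (star_interior SA) (star_0 SA) _.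
  by rewrite lexx ltr01.
move=> /near_ray[e e0 /(_ (e / 2))].
rewrite sub0r normrN gtr0_norm ?divr_gt0// => /(_ _)/radialP H.
have /H : e / 2 < e by lra.
by move=> /(_ (ltW (divr_gt0 e0 (ltr0n _ 2)))); lra.
Qed.

Lemma radial_not_interior t : ~ interior A (radial A t *: dir t).
Proof.
move=> /near_ray[e e0 /(_ (radial A t + e / 2))].
have r0 := radial_gt0 t.
rewrite opprD addrA subrr sub0r normrN gtr0_norm ?divr_gt0//.
move=> /(_ _)/radialP H; have /H : e / 2 < e by lra.
by move=> /(_ _); lra.
Qed.

Lemma lt_radial_interior t s : 0 <= s < radial A t -> interior A (s *: dir t).
Proof.
move=> /andP[s0 sr]; have r0 := radial_gt0 t.
have -> : s *: dir t = (s / radial A t) *: (radial A t *: dir t).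
  by rewrite scalerA divfK ?gt_eqF.
apply: (star_interior SA) (radial_mem t) _.
by rewrite divr_ge0 ?(ltW r0)//= ltr_pdivrMr// mul1r.
Qed.

(** Along a ray the points before the radius are interior and those after it
    are outside the closed set, so that the ray meets the boundary at the radius
    only. *)
Lemma dist0_boundary t : dist0 (half_line t `&` boundary A) = radial A t.
Proof.
have r0 := radial_gt0 t.
suff -> : half_line t `&` boundary A = [set radial A t *: dir t].
  by rewrite /dist0 image_set1 inf1 enorm_polar ?ltW.
apply/seteqP; split => [x [[s /=]]|x ->].
  rewrite in_itv/= andbT => s0 <-.
  rewrite /boundary -(iffLR (closure_id A) (star_closed SA)).
  move=> -[As nint]; have sr := (radialP t (ltW s0)).1 As.
  have [<-//|sneq] := eqVneq s (radial A t).
  case: nint; apply: lt_radial_interior.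
  by rewrite (ltW s0) lt_neqAle sneq sr.
split; first by exists (radial A t) => //=; rewrite in_itv/= r0.
split; first exact/subset_closure/radial_mem.
exact: radial_not_interior.
Qed.

(** The radius is at least [c > 0] at [t] when the point [c *: dir t], which
    moves continuously with [t], lies in a closed set; its superlevel sets are
    therefore closed. *)
Lemma measurable_radial (D : set R) : measurable D ->
  measurable_fun D (radial A).
Proof.
move=> mD; apply: measurable_funTS.
apply: (measurability (@RGenCInfty.G R)) => [|/= _ [_] [r] -> <-].
  exact: RGenCInfty.measurableE.
rewrite setTI; have -> : radial A @^-1` `[r, +oo[ =
    (fun t => Num.max r 0 *: dir t) @^-1` A.
  apply/seteqP; split => t /=; rewrite in_itv/= andbT => h.
    apply/radialP; first by rewrite le_max lexx orbT.
    by rewrite ge_max h radial_ge0.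
  have m0 : 0 <= Num.max r 0 by rewrite le_max lexx orbT.
  by have := (radialP t m0).1 h; rewrite ge_max => /andP[].
apply: closed_measurable.
apply: preimage_closed (star_closed SA) => t _.
apply: (@continuous_comp _ _ _ (@dir R) (fun x => Num.max r 0 *: x)).
  exact: continuous_dir.
exact: scaler_continuous.
Qed.

End StarBodies.

(** * Cells cut out by half-planes or by rescaled discs *)

Lemma near_finite_set (T : eqType) (U : Type) (G : set_system U) {FG : Filter G}
    (F : set T) (Q : T -> U -> Prop) : finite_set F ->
  (forall z, F z -> \forall u \near G, Q z u) ->
  \forall u \near G, forall z, F z -> Q z u.
Proof.
move=> /finite_seqP[s ->]; elim: s => [|z s IH] H; first by apply: nearW => u z.
have Hz := H z (mem_head z s).
have Hs : \forall u \near G, forall z, z \in s -> Q z u.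
  by apply: IH => z' z's; apply: H => /=; rewrite inE z's orbT.
apply: filterS2 Hz Hs => u Qz Qs z' /=.
by rewrite inE => /predU1P[->//|/Qs].
Qed.

Section Cells.
Context {R : realType}.
Implicit Types (x y : R * R) (s t eps : R) (z : mark R) (F : set (mark R)).

Definition pdist z : R := z.1.1.
Definition pangle z : R := z.1.2.
Definition pradius z : R := z.2.

(** With [eps = l ^- 2] this is [psi l], the distance from 0 to the centre of
    the disc of [z]; it stays meaningful at [eps = 0], where it is the radius. *)
Definition offset eps z : R :=
  Num.sqrt (pradius z ^+ 2 + 2 * pdist z * pradius z * eps).

(** Up to the positive factor [eps], the power of the point [eps *: x] with
    respect to the disc of [z] when [eps = l ^- 2]; at [eps = 0] it is
    proportional to the signed distance from [x] to the line of [z]. Both models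
    thus belong to one family depending continuously on [eps]. *)
Definition gap eps z x : R :=
  2 * pdist z * pradius z - 2 * offset eps z * proj (pangle z) x
  + eps * enorm x ^+ 2.

(** Discs are bounded, so the plane beyond them is uncovered again; the bound
    [M] discards this remote part. *)
Definition cell M F eps : set (R * R) :=
  [set x | enorm x <= M /\ forall z, F z -> 0 <= gap eps z x].

Lemma continuous_gap eps z : continuous (gap eps z).
Proof.
move=> x; rewrite /gap; apply: cvgD; first apply: cvgB; first exact: cvg_cst.
  by apply: cvgM; [exact: cvg_cst|exact: continuous_proj].
apply: cvgM; first exact: cvg_cst.
apply: (@continuous_comp _ _ _ (@enorm R) (fun u => u ^+ 2)).
  exact: continuous_enorm.
exact: exprn_continuous.
Qed.

Lemma gap0E z x : 0 < pradius z ->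
  gap 0 z x = 2 * pradius z * (pdist z - proj (pangle z) x).
Proof.
move=> r0; rewrite /gap /offset mulr0 addr0 sqrtr_sqr gtr0_norm//; ring.
Qed.

(** The gap is affine along a ray up to a quadratic correction, which is
    dominated by the constant term for small [eps]: this is why disc cells are
    star-shaped. *)
Lemma gapZ eps z s x : gap eps z (s *: x) = s * gap eps z x +
  (1 - s) * (2 * pdist z * pradius z - s * (eps * enorm x ^+ 2)).
Proof.
by rewrite /gap enormZ projZ exprMn real_normK ?num_real//; ring.
Qed.

Section OffsetBounds.
Variables (eps : R) (z : mark R).
Hypotheses (eps0 : 0 <= eps) (d0 : 0 < pdist z) (r0 : 0 < pradius z).

Lemma sqr_offset :
  offset eps z ^+ 2 = pradius z ^+ 2 + 2 * pdist z * pradius z * eps.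
Proof. by rewrite sqr_sqrtr// addr_ge0 ?sqr_ge0 ?mulr_ge0 // ?ltW//. Qed.

Lemma offset_ge : pradius z <= offset eps z.
Proof.
rewrite -[leLHS](ger0_norm (ltW r0)) -sqrtr_sqr /offset ler_wsqrtr// lerDl.
by rewrite !mulr_ge0 // ?ltW//.
Qed.

Lemma offset_le : offset eps z <= pradius z + pdist z * eps.
Proof.
have H : 0 <= pradius z + pdist z * eps by rewrite addr_ge0 ?mulr_ge0 // ltW.
rewrite -[leRHS]ger0_norm// -sqrtr_sqr /offset ler_wsqrtr//.
rewrite -subr_ge0 (_ : _ - _ = (pdist z * eps) ^+ 2) ?sqr_ge0//; ring.
Qed.

End OffsetBounds.

(** The polygon cut out by [F] lies in the open disc of radius [G], by the last
    field; [a] and [b] are what makes all estimates uniform in the mark. *)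
Record admissible F (a b G : R) : Prop := Admissible {
  adm_finite : finite_set F;
  adm_a : 0 < a;
  adm_b : 0 < b;
  adm_G : 0 < G;
  adm_pdist : forall z, F z -> a <= pdist z;
  adm_pradius : forall z, F z -> b <= pradius z;
  adm_circle : forall x, enorm x = G ->
    exists2 z, F z & pdist z < proj (pangle z) x
}.

Definition small_eps (a b G eps : R) :=
  0 <= eps /\ eps * (2 * G) ^+ 2 < 2 * a * b.

Section CellGeometry.
Variables (F : set (mark R)) (a b G : R).
Hypothesis HF : admissible F a b G.
Let finF := adm_finite HF.
Let a0 := adm_a HF.
Let b0 := adm_b HF.
Let G0 := adm_G HF.
Let Fa := adm_pdist HF.
Let Fb := adm_pradius HF.
Let FG := adm_circle HF.
Let M := 2 * G.
Let C := cell M F.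

Lemma pdist_gt0 z (Fz : F z) : 0 < pdist z. Proof. exact: lt_le_trans (Fa Fz). Qed.
Lemma pradius_gt0 z (Fz : F z) : 0 < pradius z. Proof. exact: lt_le_trans (Fb Fz). Qed.

Let d0 := pdist_gt0.
Let r0 := pradius_gt0.

Local Notation small_eps := (small_eps a b G).

Lemma small_eps0 : small_eps 0.
Proof. by split => //; rewrite mul0r !mulr_gt0. Qed.

Lemma small_gap_lb eps z : small_eps eps -> F z ->
  eps * M ^+ 2 < 2 * pdist z * pradius z.
Proof.
move=> [_ H] Fz; apply: (lt_le_trans H); rewrite -!mulrA ler_pM2l//.
by apply: ler_pM; rewrite ?(ltW a0) ?(ltW b0) ?Fa ?Fb.
Qed.

(** A point [x] at distance [2 G] has its midpoint with 0 beyond some line,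
    so [x] overshoots this line by more than the distance of the line to 0,
    which beats the quadratic term of the gap. *)
Lemma circle_covered eps x : small_eps eps -> enorm x = M ->
  exists2 z, F z & gap eps z x < 0.
Proof.
move=> se xM.
have : enorm (2^-1 *: x) = G.
  by rewrite enormZ xM /M gtr0_norm ?invr_gt0// mulKf.
move=> /FG[z Fz]; rewrite projZ => Hz; exists z => //.
have := small_gap_lb se Fz; rewrite /gap xM.
have := offset_ge se.1 (d0 Fz) (r0 Fz).
have {}Hz : 2 * pdist z < proj (pangle z) x by lra.
set p := proj _ _ in Hz *; set o := offset _ _ => ro.
have : pradius z * (2 * pdist z) < o * p.
  have rz := r0 Fz; have dz := d0 Fz; nra.
by move=> ? ?; lra.
Qed.

Lemma gap_gt0_interior eps x : enorm x < M ->
  (forall z, F z -> 0 < gap eps z x) -> interior (C eps) x.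
Proof.
move=> xM Fx.
have h1 : \forall y \near x, enorm y < M.
  exact: (cvgr_lt _ (@continuous_enorm R x) _ xM).
have h2 : \forall y \near x, forall z, F z -> 0 < gap eps z y.
  apply: (@near_finite_set _ _ (nbhs x)) => // z Fz.
  exact: (cvgr_gt _ (@continuous_gap eps z x) _ (Fx z Fz)).
apply: filterS2 h1 h2 => y yM Fy; split; first exact: ltW.
by move=> z Fz; exact/ltW/Fy.
Qed.

Lemma cell_scale_gt0 eps x s z : small_eps eps -> C eps x -> 0 <= s < 1 ->
  F z -> 0 < gap eps z (s *: x).
Proof.
move=> se [xM Fx] /andP[s0 s1] Fz; rewrite gapZ.
have gz := Fx z Fz; apply: ltr_wpDl; first exact: mulr_ge0.
apply: mulr_gt0; first by lra.
have := small_gap_lb se Fz.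
have : s * (eps * enorm x ^+ 2) <= eps * M ^+ 2.
  have [e0 _] := se.
  apply: (@le_trans _ _ (eps * enorm x ^+ 2)).
    by rewrite ler_piMl ?(ltW s1)// mulr_ge0 ?sqr_ge0.
  by rewrite ler_wpM2l// lerXn2r ?nnegrE ?enorm_ge0 ?mulr_ge0 // ltW.
by lra.
Qed.

Lemma star_cell eps : small_eps eps -> star_body (C eps).
Proof.
move=> se; have M0 : 0 < M by rewrite mulr_gt0.
split.
- have -> : C eps = [set x | enorm x <= M] `&`
      \bigcap_(z in F) [set x | 0 <= gap eps z x] by [].
  apply: closedI.
    apply: (@preimage_closed _ _ (@enorm R) [set u | u <= M]).
      by move=> x _; exact: continuous_enorm.
    exact: closed_le.
  apply: closed_bigI => z Fz.
  apply: (@preimage_closed _ _ (gap eps z) [set u | 0 <= u]).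
    by move=> x _; exact: continuous_gap.
  exact: closed_ge.
- by exists M => x [].
- split; first by rewrite enorm0 ltW.
  move=> z Fz; rewrite -[X in gap _ _ X](scale0r 0) gapZ !mul0r add0r.
  by rewrite !subr0 mul1r !mulr_ge0 // ltW// ?d0 ?r0.
- move=> x s Cx s01; apply: gap_gt0_interior.
    case/andP: s01 => s0 s1; rewrite enormZ ger0_norm//.
    apply: (@le_lt_trans _ _ (s * M)); first by rewrite ler_wpM2l// Cx.1.
    by rewrite gtr_pMl.
  by move=> z Fz; exact: cell_scale_gt0 Fz.
Qed.

Lemma radial_lt_M eps t : small_eps eps -> radial (C eps) t < M.
Proof.
move=> se; have SC := star_cell se.
rewrite ltNge; apply/negP => /(radialP SC) H.
have /H [_ {}H] : 0 <= M by rewrite mulr_ge0 // ?ltW//.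
have /(circle_covered se) : enorm (M *: dir t) = M.
  by rewrite enorm_polar// mulr_ge0 // ?ltW//.
by move=> [z Fz]; rewrite ltNge H.
Qed.

Lemma radial_gap_ge0 eps t z : small_eps eps -> F z ->
  0 <= gap eps z (radial (C eps) t *: dir t).
Proof. by move=> se Fz; apply: (radial_mem (star_cell se) t).2. Qed.

(** If all constraints were strict at the boundary point it would be an
    interior point, there being finitely many of them. *)
Lemma radial_gap_eq0 eps t : small_eps eps ->
  exists2 z, F z & gap eps z (radial (C eps) t *: dir t) = 0.
Proof.
move=> se; have SC := star_cell se; apply: contrapT => H.
apply: (radial_not_interior SC (t := t)); apply: gap_gt0_interior.
  by rewrite enorm_polar ?radial_ge0// radial_lt_M.
move=> z Fz; rewrite lt_neqAle radial_gap_ge0// andbT.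
by apply/eqP => /esym H'; apply: H; exists z.
Qed.

Let g t := radial (C 0) t.
Let f eps t := radial (C eps) t.

Lemma g_active_le t z : F z -> g t * cos (pangle z - t) <= pdist z.
Proof.
move=> Fz; have := radial_gap_ge0 t small_eps0 Fz.
rewrite gap0E ?r0// pmulr_rge0 ?mulr_gt0 ?r0// subr_ge0 proj_polar//.
Qed.

Lemma g_active_ex t : exists2 z, F z & g t * cos (pangle z - t) = pdist z.
Proof.
have [z Fz] := radial_gap_eq0 t small_eps0.
rewrite gap0E ?r0// proj_polar => /eqP; rewrite mulf_eq0.
rewrite gt_eqF ?mulr_gt0 ?r0//= subr_eq0 => /eqP H.
by exists z.
Qed.

Lemma g_gt0 t : 0 < g t. Proof. exact: radial_gt0 (star_cell small_eps0) t. Qed.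

Lemma g_lt t : g t < G.
Proof.
rewrite ltNge; apply/negP => /(radialP (star_cell small_eps0)) => /(_ (ltW G0)) H.
have /FG[z Fz] : enorm (G *: dir t) = G by rewrite enorm_polar// ltW.
have := H.2 z Fz; rewrite gap0E ?r0// pmulr_rge0 ?mulr_gt0 ?r0// subr_ge0.
by move=> /le_lt_trans h /h; rewrite ltxx.
Qed.

(** An edge of the polygon is seen from 0 at a non-grazing angle, because the
    polygon contains a disc of radius [a] and is contained in one of radius [G]. *)
Lemma active_cos_lb t z : F z -> g t * cos (pangle z - t) = pdist z ->
  a / G <= cos (pangle z - t).
Proof.
move=> Fz Hz; have gt := g_gt0 t; have gG := g_lt t.
rewrite ler_pdivrMr//; apply: (le_trans (Fa Fz)); rewrite -Hz mulrC.
have c0 : 0 < cos (pangle z - t) by rewrite -(pmulr_rgt0 _ gt) Hz d0.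
by rewrite ler_pM2l// ltW.
Qed.

(** The disc whose line supports the polygon in direction [t] contains, near 0,
    the half-plane behind that line up to a parabolic correction of order [eps],
    which the incidence angle amplifies by a bounded factor. *)
Lemma radial_ub eps t : small_eps eps ->
  f eps t - g t <= eps * (M ^+ 2 * G / (2 * a * b)).
Proof.
move=> se; have [z Fz Hz] := g_active_ex t.
have cG := active_cos_lb Fz Hz; have gt := g_gt0 t.
set c := cos _ in Hz cG.
have fM := radial_lt_M t se; have f0 := radial_ge0 (star_cell se) t.
have := radial_gap_ge0 t se Fz; rewrite /gap proj_polar enorm_polar//.
rewrite -/c -/(f eps t) -Hz => H.
have aG : 0 < a / G by rewrite divr_gt0.
have c0 : 0 < c by exact: lt_le_trans cG.
have rb := Fb Fz; have ro := offset_ge se.1 (d0 Fz) (r0 Fz).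
have [e0 _] := se.
have h1 : eps * f eps t ^+ 2 <= eps * M ^+ 2.
  by rewrite ler_wpM2l// lerXn2r ?nnegrE ?mulr_ge0 // ?ltW// mulr_gt0.
have h2 : pradius z * (f eps t * c) <= offset eps z * (f eps t * c).
  by rewrite ler_wpM2r// mulr_ge0// ltW.
have [fg|fg] := leP (f eps t - g t) 0.
  by apply: (le_trans fg); rewrite !mulr_ge0 ?invr_ge0 ?sqr_ge0 ?mulr_ge0 // ?ltW//.
have h3 : 2 * b * (a / G) * (f eps t - g t) <= 2 * pradius z * c * (f eps t - g t).
  rewrite ler_wpM2r//; first exact: ltW.
  rewrite -!mulrA ler_wpM2l//.
  by apply: ler_pM; rewrite // ?ltW//.
have h4 : 2 * b * (a / G) * (f eps t - g t) <= eps * M ^+ 2 by lra.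
have -> : eps * (M ^+ 2 * G / (2 * a * b)) = (eps * M ^+ 2) / (2 * b * (a / G)).
  by field; rewrite !gt_eqF.
have k0 : 0 < 2 * b * (a / G) by rewrite !mulr_gt0// invr_gt0.
by rewrite ler_pdivlMr// mulrC.
Qed.

(** A disc is contained in the half-plane beyond a line obtained by pulling
    its own line towards 0 by the factor
    [pradius / offset], and [offset <= pradius * (1 + eps * c / b)]. *)
Lemma radial_lb (c : R) eps t : (forall z, F z -> pdist z <= c) ->
  small_eps eps -> g t - f eps t <= eps * (c / b * G).
Proof.
move=> Fc se; have [e0 _] := se; have gt := g_gt0 t.
have [z0 Fz0 _] := g_active_ex t.
have c0 : 0 < c by exact: lt_le_trans (d0 Fz0) (Fc _ Fz0).
(* [k] bounds [offset eps z / pradius z] uniformly over [F]. *)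
pose k := 1 + c / b * eps.
have k1 : 1 <= k by rewrite lerDl !mulr_ge0 ?invr_ge0 // ?ltW//.
have k0 : 0 < k by exact: lt_le_trans k1.
have gk : g t / k <= f eps t.
  apply/(radialP (star_cell se)); first by rewrite divr_ge0 // ?ltW//.
  split.
    rewrite enorm_polar; last by rewrite divr_ge0// ltW.
    rewrite ler_pdivrMr//.
    have gG := g_lt t; apply: (@le_trans _ _ (M * 1)).
      by rewrite mulr1 /M; lra.
    by rewrite ler_wpM2l// mulr_ge0 // ?ltW//.
  move=> z Fz; rewrite /gap proj_polar.
  apply: addr_ge0; last by rewrite mulr_ge0 ?sqr_ge0.
  rewrite -mulrA -(mulrA 2) -mulrBr mulr_ge0// subr_ge0.
  have act := g_active_le t Fz; set cc := cos _ in act *.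
  have rz := r0 Fz; have dz := d0 Fz.
  have [cc0|cc0] := leP cc 0.
    apply: (@le_trans _ _ 0); last by rewrite mulr_ge0 // ?ltW//.
    rewrite mulr_ge0_le0 ?sqrtr_ge0// mulr_ge0_le0// divr_ge0 // ?ltW//.
  have ok : offset eps z <= pradius z * k.
    apply: (le_trans (offset_le e0 dz rz)).
    rewrite /k mulrDr mulr1 lerD2l mulrA ler_wpM2r//.
    rewrite mulrCA; apply: (le_trans (Fc _ Fz)).
    by rewrite ler_pMr// ler_pdivlMr// mul1r Fb.
  apply: (@le_trans _ _ (pradius z * k * (g t / k * cc))).
    by rewrite ler_wpM2r// mulr_ge0 ?divr_ge0 // ?ltW//.
  have -> : pradius z * k * (g t / k * cc) = g t * cc * pradius z.
    by field; rewrite gt_eqF.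
  by rewrite ler_wpM2r // ?ltW//.
move: gk; rewrite ler_pdivrMr// /k => gk.
have gG := g_lt t.
have h : g t * (c / b * eps) <= G * (c / b * eps).
  rewrite ler_wpM2r//; last exact: ltW.
  by rewrite mulr_ge0// divr_ge0// ltW.
have ke : 0 <= c / b * eps by rewrite mulr_ge0 ?divr_ge0 // ?ltW//.
have [fg|fg] := leP (f eps t) (g t).
  have h' : f eps t * (c / b * eps) <= g t * (c / b * eps) by rewrite ler_wpM2r.
  by lra.
apply: (@le_trans _ _ 0); first by lra.
by rewrite !mulr_ge0// ?invr_ge0 ltW.
Qed.

End CellGeometry.
End Cells.

(** * First-order expansion of the radial function *)

Lemma cvg_sqr (R : realType) (T : Type) (H : set_system T) {FH : Filter H}
  (u : T -> R) (v : R) : u @ H --> v -> u x ^+ 2 @[x --> H] --> v ^+ 2.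
Proof. by move=> c; exact: (cvg_comp _ _ c (@exprn_continuous R 2 v)). Qed.

Section Asymptotics.
Context {R : realType}.
Variables (F : set (mark R)) (a b G : R).
Hypothesis HF : admissible F a b G.
Let g t := radial (cell (2 * G) F 0) t.
Let f l t := radial (cell (2 * G) F (l ^- 2)) t.

Lemma cvg_invsqr0 : (l : R) ^- 2 @[l --> +oo] --> (0 : R).
Proof.
apply/(@gtr0_cvgV0 _ _ _ _ (fun l : R => l ^+ 2)).
  near=> l; rewrite exprn_gt0//; near: l; exact: nbhs_pinfty_gt.
exact: cvgr_expr2.
Unshelve. all: by end_near. Qed.

Lemma near_small_eps : \forall l \near +oo, small_eps a b G ((l : R) ^- 2).
Proof.
have [_ a0 b0 G0 _ _ _] := HF.
have c : (l : R) ^- 2 * (2 * G) ^+ 2 @[l --> +oo] --> 0 * (2 * G) ^+ 2.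
  by apply: cvgM; [exact: cvg_invsqr0|exact: cvg_cst].
have ab : 0 * (2 * G) ^+ 2 < 2 * a * b by rewrite mul0r !mulr_gt0.
have h1 : \forall l \near +oo, (l : R) ^- 2 * (2 * G) ^+ 2 < 2 * a * b.
  exact: cvgr_lt c _ ab.
apply: filterS h1 => l h; split => //.
by rewrite invr_ge0 sqr_ge0.
Qed.

Lemma radial_lipschitz : exists2 K : R, 0 <= K &
  forall eps t, small_eps a b G eps ->
    `|radial (cell (2 * G) F eps) t - g t| <= eps * K.
Proof.
have [finF a0 b0 G0 _ _ _] := HF.
have [c Fc] : exists c, forall z, F z -> pdist z <= c.
  have [s Fs] := (finite_seqP F).1 finF.
  exists (\big[Order.max/0]_(z <- s) pdist z) => z; rewrite Fs /= => zs.
  exact: le_bigmax_seq.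
pose K1 := (2 * G) ^+ 2 * G / (2 * a * b); pose K2 := c / b * G.
exists (Num.max 0 (Num.max K1 K2)); first by rewrite le_max lexx.
move=> eps t se; have [e0 _] := se.
have h1 := radial_ub HF t se; have h2 := radial_lb HF t Fc se.
have k1 : K1 <= Num.max 0 (Num.max K1 K2) by rewrite !le_max lexx !orbT.
have k2 : K2 <= Num.max 0 (Num.max K1 K2) by rewrite !le_max lexx !orbT.
rewrite ler_norml; apply/andP; split.
  by rewrite lerNl opprB; apply: (le_trans h2); rewrite ler_wpM2l.
by apply: (le_trans h1); rewrite ler_wpM2l.
Qed.

Lemma radial_cvg t : f l t @[l --> +oo] --> g t.
Proof.
have [K K0 HK] := radial_lipschitz.
have c : (l : R) ^- 2 * K @[l --> +oo] --> 0.
  by rewrite -(mul0r K); apply: cvgM; [exact: cvg_invsqr0|exact: cvg_cst].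
apply/cvgrPdist_le => e e0.
have h1 : \forall l \near +oo, (l : R) ^- 2 * K <= e by exact: cvgr_le c _ e0.
apply: filterS2 near_small_eps h1 => l sl.
by rewrite distrC; apply: le_trans; exact: HK.
Qed.

Lemma offset_cvg (z : mark R) : 0 < pradius z ->
  offset (l ^- 2) z @[l --> +oo] --> pradius z.
Proof.
move=> r0; rewrite /offset.
have c : pradius z ^+ 2 + 2 * pdist z * pradius z * l ^- 2 @[l --> +oo] -->
    pradius z ^+ 2 + 2 * pdist z * pradius z * 0.
  apply: cvgD; first exact: cvg_cst.
  by apply: cvgM; [exact: cvg_cst|exact: cvg_invsqr0].
have := cvg_comp _ _ c (@sqrt_continuous R _).
by rewrite mulr0 addr0 sqrtr_sqr gtr0_norm.
Qed.

Lemma gap_cvg (z : mark R) t : 0 < pradius z ->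
  gap (l ^- 2) z (f l t *: dir t) @[l --> +oo] --> gap 0 z (g t *: dir t).
Proof.
move=> r0; rewrite gap0E//.
have -> : 2 * pradius z * (pdist z - proj (pangle z) (g t *: dir t)) =
  2 * pdist z * pradius z - 2 * pradius z * (g t * cos (pangle z - t))
  + 0 * (`|g t| * 1) ^+ 2 by rewrite proj_polar; ring.
under eq_fun do rewrite /gap proj_polar enormZ enorm_dir.
apply: cvgD; first apply: cvgB; first exact: cvg_cst.
  apply: cvgM; first by apply: cvgM; [exact: cvg_cst|exact: offset_cvg].
  by apply: cvgM; [exact: radial_cvg|exact: cvg_cst].
apply: cvgM; first exact: cvg_invsqr0.
apply: cvg_sqr.
apply: cvgM; last exact: cvg_cst.
by apply: cvg_norm; exact: radial_cvg.
Qed.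

(** Direction [t] points to the relative interior of an edge, and [z] is the
    only mark on the line of that edge. *)
Definition sole_active t z := F z /\
  forall z', F z' -> z' <> z -> g t * cos (pangle z' - t) < pdist z'.

Lemma sole_activeE t z : sole_active t z -> g t * cos (pangle z - t) = pdist z.
Proof.
move=> [Fz uz]; have [z' Fz' Hz'] := g_active_ex HF t.
suff <- : z' = z by [].
by apply: contrapT => /(uz _ Fz'); rewrite Hz' ltxx.
Qed.

(** For large [l] the constraint of [z] stays the tight one, so the radius
    [f] solves [gap (l ^- 2) z (f *: dir t) = 0]. With [c = cos (pangle z - t)]
    and [g = pdist z / c], subtracting the same equation at [eps = 0] gives
    exactly [l ^+ 2 * (f - g) = f ^+ 2 / (2 r c) - 2 pdist z * f / (offset + r)]
    where [r = pradius z], and the right-hand side converges because [f] does. *)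
Lemma defect_cvg t z : sole_active t z ->
  l ^+ 2 * (f l t - g t) @[l --> +oo] --> limit_defect z t.
Proof.
move=> uz; have act := sole_activeE uz; have [Fz sz] := uz.
have d0 := pdist_gt0 HF Fz; have r0 := pradius_gt0 HF Fz.
have g0 : 0 < g t := g_gt0 HF t.
set c := cos _ in act.
have c0 : 0 < c by rewrite -(pmulr_rgt0 _ g0) act.
have tight : \forall l \near +oo, gap (l ^- 2) z (f l t *: dir t) = 0.
  have [finF _ _ _ _ _ _] := HF.
  have others : \forall l \near +oo, forall z', (F `\ z) z' ->
      0 < gap (l ^- 2) z' (f l t *: dir t).
    apply: (@near_finite_set _ _ (pinfty_nbhs R)).
      exact: finite_setD.
    move=> z' [Fz' /= zz']; apply: (cvgr_gt _ (@gap_cvg z' t (pradius_gt0 HF Fz'))).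
    rewrite gap0E ?(pradius_gt0 HF)// proj_polar.
    by rewrite !mulr_gt0 ?(pradius_gt0 HF)// subr_gt0 sz.
  apply: filterS2 near_small_eps others => l sl Hl.
  have [z' Fz' z'0] := radial_gap_eq0 HF t sl.
  have [<-//|zz'] := eqVneq z' z.
  suff : 0 < gap (l ^- 2) z' (f l t *: dir t) by rewrite z'0 ltxx.
  by apply: Hl; split => //; exact/eqP.
have lim : f l t ^+ 2 / (2 * pradius z * c) -
    2 * pdist z * (f l t / (offset (l ^- 2) z + pradius z))
    @[l --> +oo] --> limit_defect z t.
  have -> : limit_defect z t = g t ^+ 2 / (2 * pradius z * c) -
      2 * pdist z * (g t / (pradius z + pradius z)).
    move: (act) c0 (r0) (g0); rewrite /c /limit_defect.
    case: z {uz sz Fz d0 c act tight r0} => [[rho th] r].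
    rewrite /pangle /pdist /pradius /= => <- cp rp gp.
    have -> : cos (2 * (th - t)) = 2 * cos (th - t) ^+ 2 - 1.
      by rewrite mulr_natl cos_mulr2n mulr_natl.
    by field; rewrite !gt_eqF ?addr_gt0.
  apply: cvgB.
    apply: cvgM; last exact: cvg_cst.
    apply: cvg_sqr.
    exact: radial_cvg.
  apply: cvgM; first exact: cvg_cst.
  apply: cvgM; first exact: radial_cvg.
  apply: cvgV; first by rewrite gt_eqF ?addr_gt0.
  by apply: cvgD; [exact: offset_cvg|exact: cvg_cst].
apply: cvg_trans lim; apply: near_eq_cvg.
near=> l.
have l0 : 0 < l by near: l; exact: nbhs_pinfty_gt.
have : gap (l ^- 2) z (f l t *: dir t) = 0 by near: l.
have e0 : 0 <= l ^- 2 by rewrite invr_ge0 sqr_ge0.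
have := sqr_offset e0 d0 r0; have := offset_ge e0 d0 r0.
rewrite /gap proj_polar enormZ enorm_dir mulr1 real_normK ?num_real// -/c.
set o := offset _ _; set u := f l t => ro o2 gz.
have op : 0 < o + pradius z by rewrite addr_gt0// (lt_le_trans r0).
(* difference of squares applied to [sqr_offset] *)
have oE : o = pradius z + 2 * pdist z * pradius z * l ^- 2 / (o + pradius z).
  apply: (mulIf (lt0r_neq0 op)); rewrite mulrDl divfK ?gt_eqF//.
  by rewrite mulrDr mulrDr -!expr2 o2; ring.
apply: (mulIf (lt0r_neq0 c0)); apply: (mulIf (lt0r_neq0 r0)).
have key : 2 * pradius z * c * (u - g t) =
   l ^- 2 * (u ^+ 2 - 4 * pdist z * pradius z * c * u / (o + pradius z)).
  move: gz; rewrite {1}oE -act => gz.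
  by apply: subr0_eq; rewrite -oppr0 -gz; ring.
have -> : u - g t = l ^- 2 * (u ^+ 2 - 4 * pdist z * pradius z * c * u / (o + pradius z)) / (2 * pradius z * c).
  by rewrite -key mulrC mulKf// gt_eqF// !mulr_gt0.
by field; rewrite !gt_eqF.
Unshelve. all: by end_near. Qed.

End Asymptotics.

(** * The Crofton cell and the disc cell of a configuration *)

Section Components.
Context {R : realType}.
Implicit Types (E : set (R * R)) (x : R * R).

Lemma segment_component E x : (forall s, 0 <= s <= 1 -> E (s *: x)) ->
  connected_component E 0 x.
Proof.
move=> Ex; apply: (@connected_component_max _ E [set s *: x | s in `[0, 1]]).
- by exists 0; rewrite ?scale0r//= in_itv/= lexx ler01.
- by move=> _ [s /= + <-]; rewrite in_itv/= => /Ex.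
- apply: connected_continuous_connected; last first.
    by apply: continuous_subspaceT => s; exact: scalel_continuous.
  exact/connected_intervalP/interval_is_interval.
- by exists 1; rewrite ?scale1r//= in_itv/= lexx ler01.
Qed.

(** The image of a connected set under [h] is an interval, which cannot jump
    over a value that [h] omits. *)
Lemma component_lt (h : R * R -> R) E x c : continuous h -> h 0 < c ->
  (forall y, E y -> h y <> c) -> connected_component E 0 x -> h x < c.
Proof.
move=> ch h0 Eh [B [B0 BE conB] Bx].
rewrite ltNge; apply/negP => cx.
have : connected [set h y | y in B].
  by apply: connected_continuous_connected => //; exact: continuous_subspaceT.
move=> /connected_intervalP/(_ (h 0) (h x)).
case/(_ _ _ c) => [|||y By yc].
- by exists 0.
- by exists x.
- by rewrite (ltW h0) cx.
- exact: (Eh y (BE _ By)).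
Qed.

End Components.

Section Identification.
Context {R : realType}.
Implicit Types (x y : R * R) (l s t : R) (z : mark R).

Lemma bounded_enorm (A : set (R * R)) M :
  (forall x, A x -> enorm x <= M) -> bounded_set A.
Proof.
move=> AM; exists M; split; first exact: num_real.
move=> M' MM' x Ax; have {}AM := le_trans (AM x Ax) (ltW MM').
rewrite /= prod_normE ge_max; apply/andP; split.
  exact: le_trans (coord1_enorm x) AM.
exact: le_trans (coord2_enorm x) AM.
Qed.

(** The almost sure properties of the Poisson process on which the geometry
    rests. Distinct angles exclude two marks on the same line: their radii would
    compete in the limit. One normal direction in each open quadrant is enough to
    bound the Crofton cell. *)
Record generic_config (Rstar : R) (Z : set (mark R)) : Prop := GenericConfig {
  gen_mark : Z `<=` mark_space;
  gen_pdist : forall z, Z z -> 0 < pdist z;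
  gen_pradius : forall z, Z z -> Rstar < pradius z;
  gen_finite : forall M, finite_set (Z `&` [set z | pdist z < M]);
  gen_angle : forall z z', Z z -> Z z' -> pangle z = pangle z' -> z = z';
  gen_quadrant : forall s1 s2 : bool, exists2 z, Z z &
    0 < (-1) ^+ s1 * cos (pangle z) /\ 0 < (-1) ^+ s2 * sin (pangle z)
}.

Section Config.
Variables (Rstar : R) (Z : set (mark R)).
Hypotheses (Rstar0 : 0 < Rstar) (GZ : generic_config Rstar Z).

Lemma pdist_lb : exists2 a : R, 0 < a & forall z, Z z -> a <= pdist z.
Proof.
have [s Hs] := (finite_seqP _).1 (gen_finite GZ 1).
exists (\big[Order.min/1]_(z <- s) pdist z).
  rewrite big_seq; apply: lt_bigmin; first exact: ltr01.
  move=> z zs.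
  have [Zz _] : (Z `&` [set z | pdist z < 1]) z by rewrite Hs.
  exact: (gen_pdist GZ).
move=> z Zz; have [z1|z1] := ltP (pdist z) 1.
  apply: ge_bigmin_seq => //.
  by have : (Z `&` [set z | pdist z < 1]) z by []; rewrite Hs.
exact: le_trans (bigmin_le_id _ _ _ _) z1.
Qed.

(** When [x] lies in the same quadrant as the normal direction of a line, both
    terms of the scalar product are nonnegative, so that it grows linearly with
    the norm of [x]. *)
Lemma quadrant_bound (s1 s2 : bool) : exists p : R * R, forall x, p.1 <= enorm x ->
  0 <= (-1) ^+ s1 * x.1 -> 0 <= (-1) ^+ s2 * x.2 ->
  exists2 z, Z z & pdist z <= p.2 /\ pdist z < proj (pangle z) x.
Proof.
have [z Zz [A0 B0]] := gen_quadrant GZ s1 s2.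
set A := _ * _ in A0; set B := _ * _ in B0.
have d0 : 0 < pdist z by exact: (gen_pdist GZ).
pose m := Num.min A B; have m0 : 0 < m by rewrite lt_min A0 B0.
exists (pdist z / m + 1, pdist z) => x /= xG x1 x2; exists z => //; split=> //.
set X := _ * x.1 in x1; set Y := _ * x.2 in x2.
have pE : proj (pangle z) x = X * A + Y * B.
  rewrite /X /A /Y /B (mulrACA _ x.1) (mulrACA _ x.2).
  by rewrite -!signr_addb !addbb !mul1r.
have xXY : enorm x <= X + Y.
  rewrite -[leRHS]ger0_norm ?addr_ge0// -sqrtr_sqr ler_wsqrtr//.
  have -> : x.1 ^+ 2 = X ^+ 2.
    by rewrite exprMn sqrr_sign mul1r.
  have -> : x.2 ^+ 2 = Y ^+ 2.
    by rewrite exprMn sqrr_sign mul1r.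
  by have := mulr_ge0 x1 x2; nra.
have mA : X * m <= X * A by rewrite ler_wpM2l// ge_min lexx.
have mB : Y * m <= Y * B by rewrite ler_wpM2l// ge_min lexx orbT.
have : (pdist z / m + 1) * m <= (X + Y) * m.
  by rewrite ler_pM2r// (le_trans xG).
by rewrite mulrDl divfK ?gt_eqF// pE; lra.
Qed.

Lemma admissible_exists : exists a G r : R, 4 * G < r /\
  admissible (Z `&` [set z | pdist z < r]) a Rstar G.
Proof.
have [a a0 Za] := pdist_lb.
have [p Hp] := choice (fun s : bool * bool => quadrant_bound s.1 s.2).
pose G : R := \sum_k `|(p k).1| + 1.
pose r : R := \sum_k `|(p k).2| + 4 * G + 1.
have le_sum_abs (h : bool * bool -> R) k : h k <= \sum_k' `|h k'|.
  by rewrite (bigD1 k)//= (le_trans (ler_norm _))// lerDl sumr_ge0.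
have sum0 (h : bool * bool -> R) : 0 <= \sum_k `|h k| by exact: sumr_ge0.
have G0 : 0 < G by rewrite /G ltr_wpDl.
exists a, G, r; split.
  by rewrite /r -addrA ltr_wpDl// ltrDl ltr01.
split => //.
- exact: gen_finite GZ r.
- by move=> z [/Za].
- by move=> z [/(gen_pradius GZ)/ltW].
move=> x xG.
have [|||z Zz [zr Hz]] := Hp (x.1 < 0, x.2 < 0) x.
- rewrite xG /G; apply: (le_trans (le_sum_abs (fun k => (p k).1) _)).
  by rewrite lerDl ler01.
- by rewrite -normrEsign.
- by rewrite -normrEsign.
exists z => //; split => //=; apply: (le_lt_trans zr).
apply: (le_lt_trans (le_sum_abs (fun k => (p k).2) _)).
by rewrite /r -addrA ltrDl ltr_wpDr// mulr_gt0.
Qed.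

Variables (a G r : R).
Let F := Z `&` [set z | pdist z < r].
Hypotheses (Gr : 4 * G < r) (HF : admissible F a Rstar G).

Lemma lineE z x : line z x <-> proj (pangle z) x = pdist z.
Proof. by case: z => [[rho th] rr]. Qed.

(** Along a connected set avoiding the lines, no coordinate [proj] can cross
    the value [pdist]; conversely the intersection of open half-planes is
    star-shaped around 0. *)
Lemma crofton_componentE : connected_component (~` \bigcup_(z in Z) line z) 0 =
  [set x | forall z, Z z -> proj (pangle z) x < pdist z].
Proof.
have p0 z : proj (pangle z) 0 = 0.
  by rewrite -[X in proj _ X](scale0r 0) projZ mul0r.
apply/seteqP; split => [x Hx z Zz|x Hx].
  apply: (component_lt (@continuous_proj R (pangle z)) _ _ Hx).
    by rewrite p0; exact: (gen_pdist GZ).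
  by move=> y nL /lineE Hy; apply: nL; exists z.
apply: segment_component => s /andP[s0 s1] [z Zz /lineE]; rewrite projZ.
apply/eqP; rewrite lt_eqF//; have d0 : 0 < pdist z by exact: (gen_pdist GZ).
have [p0'|p0'] := leP (proj (pangle z) x) 0.
  by apply: le_lt_trans d0; rewrite mulr_ge0_le0.
by apply: le_lt_trans (Hx z Zz); rewrite ler_piMl// ltW.
Qed.

Lemma crofton_halfplanes : crofton_cell Z =
  [set x | forall z, Z z -> proj (pangle z) x <= pdist z].
Proof.
rewrite /crofton_cell crofton_componentE; apply/seteqP; split.
  set P := [set x | forall z, Z z -> proj (pangle z) x <= pdist z].
  have cP : closed P.
    have -> : P = \bigcap_(z in Z) [set x | proj (pangle z) x <= pdist z] by [].
    apply: closed_bigI => z Zz.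
    apply: (@preimage_closed _ _ (proj (pangle z)) [set u | u <= pdist z]).
      by move=> x _; exact: continuous_proj.
    exact: closed_le.
  rewrite (closure_id P).1//; apply: closureS => x Hx z Zz.
  exact/ltW/Hx.
move=> x Px B Bx.
have [e e0 He] : exists2 e : R, 0 < e & forall s, `|1 - s| < e -> B (s *: x).
  by apply: near_ray; rewrite scale1r; exact: Bx.
pose m := Num.min e 1; have m0 : 0 < m by rewrite lt_min e0 ltr01.
have [me m1] : m <= e /\ m <= 1 by rewrite /m !ge_min !lexx orbT.
exists ((1 - m / 2) *: x); split; last first.
  by apply: He; rewrite opprB addrCA subrr addr0 gtr0_norm; lra.
move=> z Zz; rewrite projZ; have := Px z Zz; have := gen_pdist GZ Zz.
by move=> d0 pd; nra.
Qed.

(** Lines at distance at least [r] do not reach the disc of radius [2 G], where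
    the lines of [F] confine the cell. *)
Lemma crofton_cellE : crofton_cell Z = cell (2 * G) F 0.
Proof.
have G0 := adm_G HF.
rewrite crofton_halfplanes; apply/seteqP; split => x; last first.
  move=> [xG Fx] z Zz; have [zr|zr] := ltP (pdist z) r.
    have Fz : F z by [].
    have := Fx z Fz; rewrite gap0E ?(pradius_gt0 HF)//.
    by rewrite pmulr_rge0 ?subr_ge0// mulr_gt0// (pradius_gt0 HF).
  apply: le_trans zr; apply: (le_trans (ler_norm _)).
  apply: (le_trans (proj_le _ _)); apply: (le_trans xG).
  by move: (Gr) (G0); lra.
move=> Px; split => [|z [Zz zr]]; last first.
  rewrite gap0E ?(pradius_gt0 HF)//.
  by rewrite mulr_ge0 ?subr_ge0 ?Px// mulr_ge0// ltW// (pradius_gt0 HF).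
rewrite leNgt; apply/negP => xG; have x0 : 0 < enorm x by lra.
have /(adm_circle HF)[z [Zz _]] : enorm ((G / enorm x) *: x) = G.
  by rewrite enormZ ger0_norm ?divfK ?gt_eqF// divr_ge0// ltW.
rewrite projZ ltNge => /negP; apply.
have c1 : G / enorm x <= 1 by rewrite ler_pdivrMr// mul1r; lra.
have c0 : 0 <= G / enorm x by rewrite divr_ge0// ltW.
apply: (@le_trans _ _ (G / enorm x * pdist z)).
  by rewrite ler_wpM2l// Px.
by rewrite ler_piMl// ltW// (gen_pdist GZ).
Qed.

Section Disc.
Variable l : R.
Hypothesis l0 : 0 < l.
Let eps := l ^- 2.
Let eps0 : 0 < eps. Proof. by rewrite invr_gt0 exprn_gt0. Qed.
Let el : eps * l ^+ 2 = 1.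
Proof. by rewrite mulVf// gt_eqF// exprn_gt0. Qed.

Lemma psi_offset z : 0 < pdist z -> 0 < pradius z ->
  psi l (pdist z) (pradius z) = offset eps z.
Proof.
move=> d0 r0; rewrite /psi /offset -[X in X * _](gtr0_norm r0) -sqrtr_sqr.
rewrite -sqrtrM ?sqr_ge0//; congr Num.sqrt; rewrite /eps.
by field; rewrite !gt_eqF.
Qed.

Lemma disc_gap z x : 0 < pdist z -> 0 < pradius z ->
  disc l z (eps *: x) <-> gap eps z x < 0.
Proof.
move=> d0 r0.
have -> : disc l z (eps *: x) =
    (enorm (eps *: x - offset eps z *: dir (pangle z)) < pradius z) :> Prop.
  by rewrite -psi_offset//; case: z {d0 r0} => [[rho th] rr].
have -> : (enorm (eps *: x - offset eps z *: dir (pangle z)) < pradius z) =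
    (eps * gap eps z x < 0).
  rewrite -(@ltr_pXn2r _ 2) ?nnegrE ?enorm_ge0 ?ltW// -subr_lt0; congr (_ < 0).
  have o2 := sqr_offset (ltW eps0) d0 r0.
  rewrite sqr_enorm /gap sqr_enorm /proj.
  have cs := cos2Dsin2 (pangle z).
  set o := offset _ _ in o2 *; set c := cos _ in cs *; set s := sin _ in cs *.
  have -> : (eps *: x - o *: dir (pangle z)).1 = eps * x.1 - o * c by [].
  have -> : (eps *: x - o *: dir (pangle z)).2 = eps * x.2 - o * s by [].
  have -> : (eps * x.1 - o * c) ^+ 2 + (eps * x.2 - o * s) ^+ 2 =
    eps ^+ 2 * (x.1 ^+ 2 + x.2 ^+ 2) - 2 * eps * o * (x.1 * c + x.2 * s) +
    o ^+ 2 * (c ^+ 2 + s ^+ 2) by ring.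
  by rewrite cs o2; ring.
by rewrite pmulr_rlt0.
Qed.

Hypothesis sl : small_eps a Rstar G eps.
Hypothesis sR : 4 * G * eps < Rstar.

(** After rescaling, the disc of a mark lies at distance at least
    [pdist / (1 + eps * pdist / pradius)] from 0, a bound that improves with the
    radius: remote marks are harmless although radii are unbounded. *)
Lemma far_gap_gt0 z x : Z z -> r <= pdist z -> enorm x <= 2 * G ->
  0 < gap eps z x.
Proof.
move=> Zz zr xG; have G0 := adm_G HF.
have d0 : 0 < pdist z by exact: (gen_pdist GZ).
have rR := gen_pradius GZ Zz.
have r0 : 0 < pradius z by exact: lt_trans rR.
rewrite /gap; have := offset_le (ltW eps0) d0 r0.
have : proj (pangle z) x <= 2 * G.
  by apply: (le_trans (ler_norm _)); apply: (le_trans (proj_le _ _)).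
have o0 : 0 <= offset eps z by exact: sqrtr_ge0.
have e2 : 0 <= eps * enorm x ^+ 2 by rewrite mulr_ge0 ?sqr_ge0// ltW.
set o := offset _ _ in o0 *; set p := proj _ _ => pG oU.
have h1 : o * p <= (pradius z + pdist z * eps) * (2 * G).
  by apply: (@le_trans _ _ (o * (2 * G))); [rewrite ler_wpM2l|rewrite ler_wpM2r// mulr_ge0// ltW].
have h2 : pradius z * (4 * G) < pradius z * pdist z by rewrite ltr_pM2l//; move: (Gr); lra.
have h3 : pdist z * (4 * G * eps) < pdist z * pradius z by rewrite ltr_pM2l//; move: (sR) rR; lra.
nra.
Qed.

(** The circle of radius [2 G] is covered, so the component of 0 stays inside
    it, where only the marks of [F] act; the cell they define is star-shaped,
    hence contained in the component. *)
Lemma D0_E : D0_ l Z = [set eps *: x | x in cell (2 * G) F eps].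
Proof.
have G0 := adm_G HF.
have dZ z : Z z -> 0 < pdist z by move=> Zz; exact: (gen_pdist GZ).
have rZ z : Z z -> 0 < pradius z by move=> /(gen_pradius GZ); exact: lt_trans.
have scaleK x : eps *: (l ^+ 2 *: x) = x by rewrite scalerA el scale1r.
apply/seteqP; split => [x Hx|_ [x Cx <-]].
  exists (l ^+ 2 *: x); last exact: scaleK.
  have Ex := connected_component_sub Hx.
  split.
    apply/ltW.
    apply: (@component_lt _ (fun x => enorm (l ^+ 2 *: x)) _ _ _ _ _ _ Hx).
    - move=> y; apply: (@continuous_comp _ _ _ (fun y => l ^+ 2 *: y) (@enorm R)).
        exact: scaler_continuous.
      exact: continuous_enorm.
    - by rewrite scaler0 enorm0 mulr_gt0.
    - move=> y Ey /(circle_covered HF sl)[z [Zz _] Hz]; apply: Ey; exists z => //.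
      by rewrite -(scaleK y); apply/disc_gap => //; [exact: dZ|exact: rZ].
  move=> z [Zz _]; rewrite leNgt; apply/negP => Hz; apply: Ex; exists z => //.
  by rewrite -(scaleK x); apply/disc_gap => //; [exact: dZ|exact: rZ].
apply: segment_component => s s01.
have [sxG Fsx] := star_sub (star_cell HF sl) Cx s01.
move=> [z Zz]; rewrite scalerA mulrC -scalerA disc_gap; [|exact: dZ|exact: rZ].
have [zr|zr] := ltP (pdist z) r.
  by have Fz : F z by []; rewrite ltNge Fsx.
by rewrite ltNge ltW// far_gap_gt0.
Qed.

Lemma D_E K0 : D_ K0 l Z = cell (2 * G) F eps.
Proof.
rewrite /D_ asboolT; last first.
  apply: (@bounded_enorm _ (eps * (2 * G))) => y; rewrite D0_E => -[x [xG _] <-].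
  by rewrite enormZ gtr0_norm// ler_pM2l.
rewrite D0_E; apply/seteqP; split => [_ [_ [x Cx <-] <-]|x Cx].
  by rewrite scalerA (mulrC _ eps) el scale1r.
exists (eps *: x); first by exists x.
by rewrite scalerA (mulrC _ eps) el scale1r.
Qed.

Lemma defectE K0 t : defect K0 Z l t =
  radial (cell (2 * G) F eps) t - radial (cell (2 * G) F 0) t.
Proof.
rewrite /defect D_E crofton_cellE !dist0_boundary//.
  exact: star_cell HF _ (small_eps0 HF).
exact: star_cell HF _ sl.
Qed.

End Disc.


End Config.
End Identification.

(** * Vertices and edges of the Crofton cell *)

Section PolygonVertices.
Context {R : realType}.
Implicit Types (x y v : R * R) (s t : R) (z : mark R).

Lemma finite_sorted_enum (T : set R) : finite_set T ->
  exists (n : nat) (th : 'I_n -> R),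
    (forall i j : 'I_n, (i < j)%N -> th i < th j) /\ range th = T.
Proof.
move=> /finite_seqP[s0 ->]; pose s := sort <=%O (undup s0).
have ss : sorted <%O s.
  by rewrite lt_sorted_uniq_le sort_uniq undup_uniq sort_sorted//; exact: le_total.
exists (size s), (fun i => s`_i); split => [i j ij|].
  by apply: (sorted_ltn_nth lt_trans) => //; rewrite inE.
apply/seteqP; split => [_ [i _ <-]|x] /=.
  by rewrite -mem_undup -(mem_sort <=%O) mem_nth.
rewrite -mem_undup -(mem_sort <=%O) -/s => xs.
have xi : (index x s < size s)%N by rewrite index_mem.
by exists (Ordinal xi) => //=; rewrite nth_index.
Qed.

Lemma proj2_eq0 th th' v : sin (th' - th) != 0 ->
  proj th v = 0 -> proj th' v = 0 -> v = 0.
Proof.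
move=> s0 p p'.
have e1 : v.1 * sin (th' - th) = 0.
  have -> : v.1 * sin (th' - th) = proj th v * sin th' - proj th' v * sin th.
    by rewrite sinB /proj; ring.
  by rewrite p p' !mul0r subrr.
have e2 : v.2 * sin (th' - th) = 0.
  have -> : v.2 * sin (th' - th) = proj th' v * cos th - proj th v * cos th'.
    by rewrite sinB /proj; ring.
  by rewrite p p' !mul0r subrr.
by apply: pair_ext; apply: (mulIf s0); rewrite mul0r.
Qed.

Variables (Rstar : R) (Z : set (mark R)).
Hypotheses (Rstar0 : 0 < Rstar) (GZ : generic_config Rstar Z).
Variables (a G r : R).
Let F := Z `&` [set z | pdist z < r].
Hypotheses (Gr : 4 * G < r) (HF : admissible F a Rstar G).
Let C := cell (2 * G) F 0.
Let SC : star_body C := star_cell HF (small_eps0 HF).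
Let g t := radial C t.
Let g0 t : 0 < g t. Proof. exact: g_gt0 HF t. Qed.

(** The half-plane of [z] is tight at the boundary point in direction [t]. *)
Definition active t z := F z /\ g t * cos (pangle z - t) = pdist z.

(** [active] rewritten without the radial function: [1 / g t] is the maximum
    over [F] of [cos (pangle k - t) / pdist k], attained at [z]. In this form it
    is visibly a closed condition on [t]. *)
Definition dominant z t := forall k, F k ->
  cos (pangle k - t) * pdist z <= cos (pangle z - t) * pdist k.

Lemma activeP t z : F z -> active t z <-> dominant z t.
Proof.
move=> Fz; have d0 := pdist_gt0 HF Fz; split => [[_ act] k Fk|dom].
  have c0 : 0 < cos (pangle z - t) by rewrite -(pmulr_rgt0 _ (g0 t)) act.
  have := g_active_le HF t Fk; rewrite -/(g t) -act => h.
  by have := ler_wpM2l (ltW c0) h; move: (g t) => gt; lra.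
have [k Fk actk] := g_active_ex HF t; rewrite -/(g t) in actk.
have dk := pdist_gt0 HF Fk; split => //; apply/eqP; rewrite eq_le.
rewrite (g_active_le HF t Fz)/= -(ler_pM2l dk) -{1}actk.
have := ler_wpM2l (ltW (g0 t)) (dom k Fk).
by move: (g t) => gt; lra.
Qed.

Definition vertex_angle t := exists z z', [/\ active t z, active t z' & z <> z'].

Lemma sole_active_of t z : active t z -> ~ vertex_angle t ->
  sole_active F G t z.
Proof.
move=> az nv; have [Fz Hz] := az; split => // k Fk kz.
rewrite lt_neqAle (g_active_le HF t Fk) andbT; apply/eqP => Hk.
by apply: nv; exists k, z; split.
Qed.

Lemma active_ex t : exists z, active t z.
Proof. by have [z Fz Hz] := g_active_ex HF t; exists z. Qed.

Lemma continuous_cosB th : continuous (fun t : R => cos (th - t)).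
Proof.
move=> t; apply: (@continuous_comp _ _ _ (fun t => th - t) (@cos R)).
  by apply: cvgB; [exact: cvg_cst|exact: cvg_id].
exact: continuous_cos.
Qed.

Lemma closed_dominant z : closed [set t | dominant z t].
Proof.
have -> : [set t | dominant z t] = \bigcap_(k in F)
   [set t | 0 <= cos (pangle z - t) * pdist k - cos (pangle k - t) * pdist z].
  by apply/seteqP; split => t H k /H; rewrite /= subr_ge0.
apply: closed_bigI => k Fk.
apply: (@preimage_closed _ _ (fun t => cos (pangle z - t) * pdist k -
   cos (pangle k - t) * pdist z) [set u | 0 <= u]); last exact: closed_ge.
move=> t _; apply: cvgB; apply: cvgM; try exact: cvg_cst; exact: continuous_cosB.
Qed.

Lemma itvcc_sub_closure (p q : R) : p < q -> `[p, q] `<=` closure (`]p, q[ : set R).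
Proof.
move=> pq t /=; rewrite in_itv/= => tpq B /nbhs_ballP[e /= e0 He].
pose m := Num.min (e / 2) ((q - p) / 4).
have [m0 me mq] : [/\ 0 < m, m <= e / 2 & m <= (q - p) / 4].
  by rewrite /m !ge_min !lexx orbT lt_min !divr_gt0// subr_gt0.
have [h|h] := leP t ((p + q) / 2).
  exists (t + m); split; first by rewrite /= in_itv/=; lra.
  by apply: He; rewrite /ball/= opprD addrA subrr add0r normrN gtr0_norm; lra.
exists (t - m); split; first by rewrite /= in_itv/=; lra.
by apply: He; rewrite /ball/= opprB addrCA subrr addr0 gtr0_norm; lra.
Qed.

Lemma closed_itv_closure (A : set R) (p q : R) : p < q -> closed A ->
  `]p, q[ `<=` A -> `[p, q] `<=` A.
Proof.
move=> pq cA sA; apply: subset_trans (itvcc_sub_closure pq) _.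
by rewrite (closure_id A).1//; exact: closureS.
Qed.

(** Away from vertex angles exactly one mark is dominant, strictly so over the
    other finitely many; hence the set of angles where a given mark is dominant
    is both open and closed in an interval free of vertex angles. *)
Lemma one_active_between p q : p < q ->
  (forall t, p < t < q -> ~ vertex_angle t) ->
  exists2 z, F z & forall t, p <= t <= q -> active t z.
Proof.
move=> pq nv; have [z az] := active_ex ((p + q) / 2).
have [Fz _] := az; exists z => //.
suff sub : `]p, q[ `<=` [set t | dominant z t].
  have := closed_itv_closure pq (@closed_dominant z) sub.
  by move=> H t tpq; apply/activeP => //; apply: H; rewrite /= in_itv.
have con : connected (`]p, q[ : set R).
  exact/connected_intervalP/interval_is_interval.
rewrite -[X in X `<=` _](con (`]p, q[ `&` [set t | dominant z t])).
- by apply: subIsetr.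
- exists ((p + q) / 2); split; last exact/activeP.
  by rewrite /= in_itv/=; lra.
- exists [set t | forall k, (F `\ z) k ->
     cos (pangle k - t) * pdist z < cos (pangle z - t) * pdist k].
    rewrite openE => t /= Ht; rewrite /interior.
    apply: (@near_finite_set _ _ (nbhs t)).
      by apply: finite_setD; exact: adm_finite HF.
    move=> k Fk; have := Ht k Fk; rewrite -subr_gt0 => h.
    have c : cos (pangle z - t') * pdist k - cos (pangle k - t') * pdist z
       @[t' --> t] --> cos (pangle z - t) * pdist k - cos (pangle k - t) * pdist z.
      by apply: cvgB; apply: cvgM; try exact: cvg_cst; exact: continuous_cosB.
    have h1 : \forall t' \near t,
        0 < cos (pangle z - t') * pdist k - cos (pangle k - t') * pdist z.
      exact: (cvgr_gt _ c _ h).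
    by apply: filterS h1 => t'; rewrite subr_gt0.
  apply/seteqP; split => t [/= tpq dom]; split => //.
    move=> k [Fk /= kz]; rewrite lt_neqAle (dom k Fk) andbT; apply/eqP => e.
    have : active t z by exact/activeP.
    move: (tpq); rewrite in_itv/= => /nv nvt azt.
    have := (sole_active_of azt nvt).2 k Fk kz.
    rewrite -(ltr_pM2l (pdist_gt0 HF Fz)) -/(g t).
    have -> : pdist z * (g t * cos (pangle k - t)) = pdist z * pdist k.
      by rewrite mulrCA (mulrC (pdist z)) e mulrA azt.2.
    by rewrite ltxx.
  move=> k Fk; have [->//|/eqP kz] := eqVneq k z.
  exact/ltW/dom.
- by exists [set t | dominant z t] => //; exact: closed_dominant.
Qed.

Lemma proj_active t z : active t z -> proj (pangle z) (g t *: dir t) = pdist z.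
Proof. by move=> [_ <-]; rewrite proj_polar. Qed.

Lemma cell_proj_le x z : C x -> F z -> proj (pangle z) x <= pdist z.
Proof.
move=> [_ Hx] Fz; have := Hx z Fz; rewrite gap0E ?(pradius_gt0 HF)//.
by rewrite pmulr_rge0 ?subr_ge0// mulr_gt0// (pradius_gt0 HF).
Qed.

(** Two distinct lines touching the polygon at one point are not parallel:
    equal normals are excluded by genericity, opposite ones because 0 lies
    strictly on the inner side of both. *)
Lemma active_transversal t z z' : active t z -> active t z' -> z <> z' ->
  sin (pangle z' - pangle z) != 0.
Proof.
move=> az az' zz'; have [[Zz _] _] := az; have [[Zz' _] _] := az'.
apply/eqP => s0; have := sin0cos1 s0.
have dE : dir (pangle z') = cos (pangle z' - pangle z) *: dir (pangle z) :> R * R.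
  have h : pangle z' = pangle z + (pangle z' - pangle z) by rewrite addrC subrK.
  apply: pair_ext; rewrite coordE /=.
    by rewrite {1}h cosD s0 mulr0 subr0 mulrC.
  by rewrite {1}h sinD s0 mulr0 addr0 mulrC.
have angle_itv k : Z k -> 0 <= pangle k < 2 * pi.
  by case: k => [[rho th] rr] /(gen_mark GZ)[[_ /=]]; rewrite in_itv.
case: (ger0P (cos (pangle z' - pangle z))) => _ c1.
  apply: zz'; apply: (gen_angle GZ Zz Zz').
  by apply: dir_inj; [exact: angle_itv|exact: angle_itv|rewrite dE c1 scale1r].
have := proj_active az'; have := proj_active az.
have -> : proj (pangle z') (g t *: dir t) = - proj (pangle z) (g t *: dir t).
  have c2 : cos (pangle z' - pangle z) = -1 by rewrite -c1 opprK.
  move: dE; rewrite c2 => -[e1 e2]; rewrite /proj e1 e2 !scaleN1r; ring.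
move=> -> e; have := gen_pdist GZ Zz; have := gen_pdist GZ Zz'; lra.
Qed.

Definition vertex_angles := [set t | 0 <= t < 2 * pi /\ vertex_angle t].

Lemma polar_inj t t' : 0 <= t < 2 * pi -> 0 <= t' < 2 * pi ->
  g t *: dir t = g t' *: dir t' -> t = t'.
Proof.
move=> t2 t'2 e; apply: dir_inj => //.
have : enorm (g t *: dir t) = enorm (g t' *: dir t') by rewrite e.
rewrite !enorm_polar ?(ltW (g0 _))// => gg.
have : (g t)^-1 *: (g t *: dir t) = (g t)^-1 *: (g t' *: dir t') by rewrite e.
by rewrite -gg !scalerA mulVf ?scale1r// gt_eqF.
Qed.

(** Two transversal lines meet at most once, so each pair of marks gives at
    most one vertex angle. *)
Lemma finite_vertex_angles : finite_set vertex_angles.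
Proof.
have finF := adm_finite HF.
pose T (p : mark R * mark R) := [set t | [/\ 0 <= t < 2 * pi, active t p.1,
  active t p.2 & p.1 <> p.2]].
apply: (@sub_finite_set _ _ (\bigcup_(p in F `*` F) T p)).
  move=> t [t2 [z [z' [az az' zz']]]]; exists (z, z') => //.
  by split; [exact: az.1|exact: az'.1].
apply: bigcup_finite; first exact: finite_setX.
move=> p _; apply: (@sub_finite_set _ _ [set xget 0 (T p)]); last exact: finite_set1.
move=> t Tt; have [t2 a1 a2 pp] := Tt.
have [t'2 a1' a2' _] := xgetPex 0 (ex_intro _ t Tt).
apply: polar_inj => //; apply/eqP; rewrite -subr_eq0; apply/eqP.
apply: (proj2_eq0 (active_transversal a1 a2 pp)).
  by rewrite projB (proj_active a1) (proj_active a1') subrr.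
by rewrite projB (proj_active a2) (proj_active a2') subrr.
Qed.

(** A boundary point with a single tight half-plane can be moved both ways along
    the line, and one below the radius along its ray; two transversal tight
    half-planes leave no room for either. *)
Lemma extreme_points_vertices :
  extreme_points C = [set g t *: dir t | t in vertex_angles].
Proof.
apply/seteqP; split => [x [Cx ext]|_ [t [t2 [z [z' [az az' zz']]]] <-]].
  have [t [t2 xE]] := polarP x.
  have Ct : C (enorm x *: dir t) by rewrite -xE.
  have xg := (radialP SC t (enorm_ge0 x)).1 Ct.
  have midpoint y v : C (y - v) -> C (y + v) -> x = y -> v = 0.
    move=> C1 C2 xy; have half : 0 < (1 / 2 : R) < 1 by lra.
    have /(ext _ _ _ C1 C2 half) [e1 e2] : x = (1 - 1 / 2) *: (y - v) + (1 / 2) *: (y + v).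
      by rewrite xy; apply: pair_ext; rewrite !coordE; lra.
    by apply: pair_ext => /=; lra.
  have {xg} xg : enorm x = g t.
    apply/eqP; rewrite eq_le xg/= leNgt; apply/negP => xlt.
    have /near_ray[e e0 He] : interior C (enorm x *: dir t).
      by apply: lt_radial_interior => //; rewrite enorm_ge0.
    have : (e / 2) *: dir t = 0 :> R * R.
      apply: (midpoint (enorm x *: dir t)) => //.
        rewrite -scalerBl; apply: He; rewrite opprB addrCA subrr addr0.
        by rewrite gtr0_norm; lra.
      rewrite -scalerDl; apply: He; rewrite opprD addrA subrr add0r normrN.
      by rewrite gtr0_norm; lra.
    move=> /(congr1 (@enorm R)); rewrite enorm_polar ?enorm0; lra.
  exists t; last by rewrite xE xg.
  split => //; apply: contrapT => nv.
  have [z az] := active_ex t; have [Fz sole] := sole_active_of az nv.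
  pose v : R * R := (- sin (pangle z), cos (pangle z)).
  have nearC : \forall tau \near (0 : R), C (x + tau *: v).
    have cx : (x + tau *: v) @[tau --> (0 : R)] --> x.
      have {2}-> : x = x + 0 *: v by rewrite scale0r addr0.
      by apply: cvgD; [exact: cvg_cst|exact: scalel_continuous].
    have h1 : \forall tau \near (0 : R), enorm (x + tau *: v) < 2 * G.
      apply: (cvgr_lt _ (cvg_comp _ _ cx (@continuous_enorm R x))).
      rewrite xg; have := g_lt HF t; have := adm_G HF; rewrite -/(g t); lra.
    have h2 : \forall tau \near (0 : R), forall k, (F `\ z) k ->
        proj (pangle k) (x + tau *: v) < pdist k.
      apply: (@near_finite_set _ _ (nbhs (0 : R))).
        by apply: finite_setD; exact: adm_finite HF.
      move=> k [Fk /= kz].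
      apply: (cvgr_lt _ (cvg_comp _ _ cx (@continuous_proj R (pangle k) x))).
      by rewrite xE proj_polar xg sole.
    apply: filterS2 h1 h2 => tau xG xF; split; first exact: ltW.
    move=> k Fk; rewrite gap0E ?(pradius_gt0 HF)//.
    rewrite mulr_ge0 ?subr_ge0//; first by rewrite mulr_ge0// ltW// (pradius_gt0 HF).
    have [->|/eqP kz] := eqVneq k z; last by apply/ltW/xF.
    rewrite projD projZ {1}xE xg proj_active//.
    by rewrite (_ : proj (pangle z) v = 0) ?mulr0 ?addr0// /proj /v/=; ring.
  have /nbhs_ballP[e /= e0 He] := nearC.
  have v0 : (e / 2) *: v = 0.
    apply: (midpoint x) => //.
      rewrite -scaleNr; apply: He; rewrite /ball/= sub0r opprK.
      by rewrite gtr0_norm; lra.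
    by apply: He; rewrite /ball/= sub0r normrN gtr0_norm; lra.
  have : enorm ((e / 2) *: v) = e / 2.
    rewrite enormZ gtr0_norm ?divr_gt0// /enorm /= sqrrN addrC cos2Dsin2.
    by rewrite sqrtr1 mulr1.
  by rewrite v0 enorm0; lra.
split; first exact: radial_mem.
move=> y w s Cy Cw /andP[s0 s1] xE.
have onl k : active t k -> proj (pangle k) (y - w) = 0.
  move=> ak; have py := cell_proj_le Cy ak.1; have pw := cell_proj_le Cw ak.1.
  have := proj_active ak; rewrite xE (projD _ ((1 - s) *: y)) !projZ projB.
  have := mulr_ge0 (ltW s0) (_ : 0 <= pdist k - proj (pangle k) w).
  rewrite subr_ge0 => /(_ pw); rewrite le_eqVlt => /predU1P[/esym/eqP|].
    rewrite mulf_eq0 (gt_eqF s0)/= subr_eq0 => /eqP <- e.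
    have s1' : 1 - s != 0 by rewrite subr_eq0 gt_eqF.
    by apply: (mulfI s1'); lra.
  have := mulr_ge0 (_ : 0 <= 1 - s) (_ : 0 <= pdist k - proj (pangle k) y).
  by rewrite !subr_ge0 => /(_ (ltW s1) py); lra.
apply/eqP; rewrite -subr_eq0; apply/eqP.
exact: (proj2_eq0 (active_transversal az az' zz')) (onl _ az) (onl _ az').
Qed.

Lemma g_periodic t : g (t + 2 * pi) = g t.
Proof. by rewrite /g /radial dirD2pi. Qed.

Lemma active_periodic t z : active (t + 2 * pi) z <-> active t z.
Proof.
rewrite /active g_periodic opprD addrA.
have -> : cos (pangle z - t - 2 * pi) = cos (pangle z - t).
  by rewrite -(cosD2pi (_ - 2 * pi)) mulr2n mulrDl mul1r subrK.
by [].
Qed.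

Lemma vertex_angle_periodic t : vertex_angle (t + 2 * pi) <-> vertex_angle t.
Proof.
split => -[z [z' [az az' zz']]]; exists z, z'.
  by split; [exact: (active_periodic t z).1|exact: (active_periodic t z').1|].
by split; [exact: (active_periodic t z).2|exact: (active_periodic t z').2|].
Qed.

(** Otherwise one line would be active in all directions, even in the one
    opposite to its normal. *)
Lemma vertex_angles_neq0 : vertex_angles !=set0.
Proof.
have pi0 := @pi_gt0 R.
apply: contrapT => T0.
have nov t : 0 <= t < 2 * pi -> ~ vertex_angle t.
  by move=> t2 vt; apply: T0; exists t.
have [|t t4|z Fz Hz] := @one_active_between 0 (4 * pi); first by lra.
  have [t2|t2] := ltP t (2 * pi); first by apply: nov; lra.
  by rewrite -(subrK (2 * pi) t) => /(vertex_angle_periodic (t - 2 * pi)).1; apply: nov; lra.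
have z2 : 0 <= pangle z < 2 * pi.
  by case: z Fz {Hz} => [[rho th] rr] [/(gen_mark GZ)[[_ /=]]]; rewrite in_itv.
have /Hz[_] : 0 <= pangle z + pi <= 4 * pi by lra.
have -> : pangle z - (pangle z + pi) = - pi by ring.
rewrite cosN cospi mulrN1 => h.
by have := pdist_gt0 HF Fz; have := g0 (pangle z + pi); lra.
Qed.

Section Enumeration.
Variables (n : nat) (th : 'I_n -> R).
Hypothesis th_lt : forall i j : 'I_n, (i < j)%N -> th i < th j.
Hypothesis th_range : range th = vertex_angles.

Let th_itv i : 0 <= th i < 2 * pi.
Proof. by have [] : vertex_angles (th i) by rewrite -th_range; exists i. Qed.

Lemma th_homo_lt (i j : 'I_n) : th i < th j -> (i < j)%N.
Proof.
move=> ij; rewrite ltnNge; apply/negP; rewrite leq_eqVlt => /predU1P[e|/th_lt].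
  by move: ij; rewrite (ord_inj e) ltxx.
by rewrite ltNge ltW.
Qed.

(** The angle of the next vertex, lifted so that it follows [th i] on the real
    line; this turns cyclic arcs into intervals. *)
Definition arc_end i : R :=
  if th i < th (ordS i) then th (ordS i) else th (ordS i) + 2 * pi.

Lemma ordS_cases (i : 'I_n) : (i.+1 < n)%N /\ (ordS i = i.+1 :> nat) \/
  (i.+1 = n)%N /\ (ordS i = 0%N :> nat).
Proof.
have := ltn_ord i; rewrite leq_eqVlt => /predU1P[e|lt].
  by right; split => //=; rewrite e modnn.
by left; split => //=; rewrite modn_small.
Qed.

Lemma arc_end_gt i : th i < arc_end i.
Proof.
rewrite /arc_end; case: ifPn => // _.
by have := th_itv i; have := th_itv (ordS i); lra.
Qed.

Lemma no_vertex_in_arc i t : th i < t < arc_end i -> ~ vertex_angle t.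
Proof.
have onth u : 0 <= u < 2 * pi -> vertex_angle u -> exists j, u = th j.
  move=> u2 vu; have : vertex_angles u by [].
  by rewrite -th_range => -[j _ <-]; exists j.
move=> /andP[t1 t2] vt; have i2 := th_itv i; have s2 := th_itv (ordS i).
have [[lt Si]|[lt Si]] := ordS_cases i.
  move: t2; rewrite /arc_end th_lt ?Si// => t2.
  have [||j tj] := onth t; [lra|by []|].
  move: t1 t2; rewrite tj => /th_homo_lt ij /th_homo_lt.
  by rewrite Si ltnS leqNgt ij.
have notlt : (th i < th (ordS i)) = false.
  by apply/negP => /th_homo_lt; rewrite Si.
move: t2; rewrite /arc_end notlt => t2.
have [tpi|tpi] := ltP t (2 * pi).
  have [||j tj] := onth t; [lra|by []|].
  move: t1; rewrite tj => /th_homo_lt; rewrite ltnNge.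
  by rewrite -ltnS lt ltn_ord.
have [||j tj] := onth (t - 2 * pi); first lra.
  by apply: (vertex_angle_periodic (t - 2 * pi)).1; rewrite subrK.
have /th_homo_lt : th j < th (ordS i) by lra.
by rewrite Si.
Qed.

Lemma arc_cover t : (0 < n)%N -> 0 <= t < 2 * pi -> exists i, angular_arc th i t.
Proof.
move=> n0 t2.
have [/existsP[i0 Hi0]|] := boolP [exists i, th i <= t]; last first.
  move=> /existsPn nle.
  have nn : (n.-1 < n)%N by rewrite prednK.
  exists (Ordinal nn); split => //.
  have lastS : ordS (Ordinal nn) = 0%N :> nat by rewrite /= prednK// modnn.
  rewrite ifF; last by apply/negP => /th_homo_lt; rewrite lastS.
  by rewrite orbC ltNge (nle _).
case: (@arg_maxnP _ i0 (fun i => th i <= t) (fun i : 'I_n => val i) Hi0).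
move=> i iti imax; exists i; split => //.
have [[lt Si]|[lt Si]] := ordS_cases i; last first.
  by rewrite ifF ?iti//; apply/negP => /th_homo_lt; rewrite Si.
rewrite th_lt ?Si// iti/= ltNge; apply/negP => /imax /=.
by rewrite -[X in (X <= _)%N]/(nat_of_ord (ordS i)) Si ltnn.
Qed.

Lemma arc_active i t z : (forall u, th i <= u <= arc_end i -> active u z) ->
  angular_arc th i t -> active t z.
Proof.
move=> H [t2]; have := th_itv i; have := th_itv (ordS i); rewrite /arc_end in H.
case: ifPn H => [_ H _ _ /andP[h1 h2]|_ H S2 i2 /orP[h|h]].
- by apply: H; rewrite h1 ltW.
- by apply: H; lra.
- by apply: (active_periodic t z).1; apply: H; lra.
Qed.

End Enumeration.

Lemma crofton_polygon_exists : exists n (V : 'I_n -> R * R) th (e : 'I_n -> mark R),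
  [/\ crofton_polygon Z V th e,
      forall t, 0 <= t < 2 * pi -> exists i, angular_arc th i t,
      forall i t, angular_arc th i t -> active t (e i) &
      finite_set vertex_angles].
Proof.
have [n [th [th_lt th_range]]] := finite_sorted_enum finite_vertex_angles.
have n0 : (0 < n)%N.
  have [t] := vertex_angles_neq0; rewrite -th_range => -[i _ _].
  exact: leq_ltn_trans (ltn_ord i).
have th_itv i : 0 <= th i < 2 * pi.
  by have [] : vertex_angles (th i) by rewrite -th_range; exists i.
have ex i : exists z, F z /\ forall t, th i <= t <= arc_end th i -> active t z.
  have [|z Fz Hz] := one_active_between (arc_end_gt th_range i).
    by move=> t; exact: no_vertex_in_arc.
  by exists z.
have [e He] := choice ex.
exists n, (fun i => g (th i) *: dir (th i)), th, e.
have CE : crofton_cell Z = C by exact: (crofton_cellE GZ Gr HF).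
split; last exact: finite_vertex_angles.
- split => //.
  + rewrite CE extreme_points_vertices -th_range; apply/seteqP; split.
      by move=> _ [i _ <-]; exists (th i) => //; exists i.
    by move=> _ [_ [i _ <-] <-]; exists i.
  + move=> i /(congr1 (@enorm R)); rewrite enorm0 enorm_polar; last exact: ltW.
    by apply/eqP; rewrite gt_eqF.
  + by move=> i; rewrite enorm_polar// ltW.
  + by move=> i; have [[]] := He i.
  + move=> i _ [s /= s01 <-].
    have [Fe act] := He i.
    have gt_i := arc_end_gt th_range i.
    have a1 : active (th i) (e i) by apply: act; rewrite lexx ltW.
    have a2 : active (th (ordS i)) (e i).
      have : active (arc_end th i) (e i) by apply: act; rewrite lexx ltW.
      by rewrite /arc_end; case: ifPn => // _ /(active_periodic _ _).1.
    apply/lineE; rewrite projD (projZ _ (1 - s)) (projZ _ s).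
    by rewrite (proj_active a1) (proj_active a2); lra.
- by move=> t; exact: arc_cover.
- move=> i t; apply: arc_active => // u; exact: (He i).2.
Qed.

End PolygonVertices.

(** * Convergence in mean over the directions *)

Section L1Convergence.
Context {R : realType}.

(** Limits at [+oo] are tested along sequences, to which dominated convergence
    applies once their terms exceed a threshold beyond which the bound holds. *)
Lemma cvg_L1_bounded (D N : set R) (F : R -> R -> R) (X : R -> R) (K : R) :
  measurable D -> (@lebesgue_measure R D < +oo)%E -> countable N ->
  measurable_fun D X ->
  (\forall l \near +oo, measurable_fun D (F l) /\
     forall t, D t -> `|F l t| <= K) ->
  (forall t, D t -> ~ N t -> F l t @[l --> +oo] --> X t) ->
  cvg_L1 D F X.
Proof.
move=> mD Doo cN mX nearF FX.
pose mu := @lebesgue_measure R.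
have bdd_int (f : R -> R) : measurable_fun D f -> (forall t, D t -> `|f t| <= K) ->
    mu.-integrable D (EFin \o f).
  move=> mf fK; apply: measurable_bounded_integrable => //.
  exists K; split; first exact: num_real.
  by move=> M KM t Dt; rewrite /= (le_trans (fK _ Dt))// ltW.
have [M [_ HM]] := nearF.
have seq_cvg (u : R^nat) : u @ \oo --> +oo -> (forall n, M < u n) ->
    mu.-integrable D (EFin \o X) /\
    (\int[mu]_(t in D) `|F (u n) t - X t|%:E)%E @[n --> \oo] --> 0%E.
  move=> uoo uM.
  have [] := @dominated_convergence _ _ R mu D mD (fun n => EFin \o F (u n))
      (EFin \o X) (EFin \o cst K).
  - by move=> n; apply/measurable_EFinP; exact: (HM _ (uM n)).1.
  - exact/measurable_EFinP.
  - exists N; split; [|exact: countable_lebesgue_measure0|].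
      exact: countable_measurable.
    move=> t /= Ht; apply: contrapT => nNt; apply: Ht => Dt.
    apply: cvg_EFin; first exact: nearW.
    have /cvg_pinftyP := FX t Dt nNt; exact.
  - apply: measurable_bounded_integrable => //.
    exists `|K|; split; first exact: num_real.
    by move=> M' KM' t Dt; rewrite /= ltW.
  - by apply: aeW => t n Dt; rewrite /= lee_fin; exact: (HM _ (uM n)).2.
  - by move=> iX cv _; split => //.
split.
- have [|n|//] := seq_cvg (fun n => `|M| + 1 + n%:R).
    apply: ger_cvgy cvgr_idn; apply: nearW => n.
    by rewrite lerDr addr_ge0.
  by have := ler_norm M; have := ler0n R n; lra.
- apply: filterS nearF => l [mF FK]; exact: bdd_int.
- apply/cvge_pinftyP => u uoo.
  (* [v] agrees with [u] eventually and exceeds the threshold everywhere. *)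
  pose v n := Num.max (u n) (M + 1).
  have [||_ cv] := seq_cvg v.
  + by apply: ger_cvgy uoo; apply: nearW => n; rewrite le_max lexx.
  + by move=> n; rewrite lt_max ltrDl ltr01 orbT.
  + apply: cvg_trans cv; apply: near_eq_cvg.
    have uM : \forall n \near \oo, M + 1 <= u n by exact: cvgry_ge uoo _.
    apply: filterS uM => n Mn.
    by rewrite /v (max_idPl Mn).
Qed.

Lemma measurable_angular_arc n (th : 'I_n -> R) i :
  measurable (angular_arc th i).
Proof.
rewrite /angular_arc; case: (th i < th (ordS i)).
  have -> : [set t | 0 <= t < 2 * pi /\ th i <= t < th (ordS i)] =
    `[0, 2 * pi[ `&` `[th i, th (ordS i)[ :> set R.
    by apply/seteqP; split => t /=; rewrite !in_itv.
  by apply: measurableI; exact: measurable_itv.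
have -> : [set t | 0 <= t < 2 * pi /\ (th i <= t) || (t < th (ordS i))] =
    `[0, 2 * pi[ `&` (`[th i, +oo[ `|` `]-oo, th (ordS i)[) :> set R.
  apply/seteqP; split => t /=; rewrite !in_itv/= andbT; by case => ? /orP.
by apply: measurableI; [exact: measurable_itv|apply: measurableU; exact: measurable_itv].
Qed.

End L1Convergence.

Section DeterministicLimit.
Context {R : realType}.
Variables (Rstar : R) (Z : set (mark R)).
Hypotheses (Rstar0 : 0 < Rstar) (GZ : generic_config Rstar Z).

(** On the directions where [z] is active, [1 / cos] is [g / pdist z], which
    avoids dealing with the zeros of the cosine. *)
Lemma measurable_limit_defect (D : set R) z (g : R -> R) :
  measurable_fun D g -> pdist z != 0 ->
  (forall t, D t -> g t * cos (pangle z - t) = pdist z) ->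
  measurable D -> measurable_fun D (limit_defect z).
Proof.
move=> mg d0 act mD.
pose h (t : R) : R := - (pdist z ^+ 2 / (2 * pradius z)) *
  (cos (2 * (pangle z - t)) * (g t / pdist z) ^+ 3).
suff : measurable_fun D h.
  apply: eq_measurable_fun => t /set_mem Dt; rewrite /h; have := act t Dt.
  case: z d0 {act h} => [[rho th] rr]; rewrite /pdist /pangle /pradius /= => d0 act'.
  congr (_ * (_ * _)); rewrite -exprVn -act'; congr (_ ^+ _).
  have : g t * cos (th - t) != 0 by rewrite act'.
  rewrite mulf_eq0 negb_or => /andP[g0 c0].
  by rewrite invfM mulrA mulfV ?mul1r.
apply: measurable_funM; first exact: measurable_cst.
apply: measurable_funM.
  apply: measurable_funTS; apply: continuous_measurable_fun => t.
  apply: (@continuous_comp _ _ _ (fun t => 2 * (pangle z - t)) (@cos R)).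
    apply: cvgM; first exact: cvg_cst.
    by apply: cvgB; [exact: cvg_cst|exact: cvg_id].
  exact: continuous_cos.
apply: measurable_funX; apply: measurable_funM => //; exact: measurable_cst.
Qed.

(** Off the finitely many vertex angles the rescaled defect converges pointwise,
    and it is bounded because the radius is Lipschitz in [eps = lam ^- 2]. *)
Lemma config_cvg_L1 (K0 : set (R * R)) :
  exists n (V : 'I_n -> R * R) th (e : 'I_n -> mark R),
    crofton_polygon Z V th e /\
    forall X : R -> R,
      (forall i t, angular_arc th i t -> X t = limit_defect (e i) t) ->
      cvg_L1 `]0, 2 * pi[ (fun lam t => lam ^+ 2 * defect K0 Z lam t) X.
Proof.
have [a [G [r [Gr HF]]]] := admissible_exists Rstar0 GZ.
have [n [V [th [e [poly cover act finT]]]]] := crofton_polygon_exists GZ Gr HF.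
exists n, V, th, e; split => // X HX.
set F := Z `&` [set z | pdist z < r] in HF act.
pose g t := radial (cell (2 * G) F 0) t.
have D2 (t : R) : `]0, 2 * pi[%classic t -> 0 <= t < 2 * pi.
  by rewrite /= in_itv/= => /andP[/ltW -> ->].
have mg (D : set R) : measurable D -> measurable_fun D g.
  exact: (measurable_radial (star_cell HF (small_eps0 HF))).
have [K K0' HK] := radial_lipschitz HF.
have near_good : \forall l \near +oo, [/\ 0 < l, small_eps a Rstar G (l ^- 2) &
    4 * G * l ^- 2 < Rstar].
  have h1 : \forall l \near +oo, 0 < (l : R) by exact: nbhs_pinfty_gt.
  have h3 : \forall l \near +oo, 4 * G * (l : R) ^- 2 < Rstar.
    have c : 4 * G * (l : R) ^- 2 @[l --> +oo] --> 4 * G * 0.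
      by apply: cvgM; [exact: cvg_cst|exact: cvg_invsqr0].
    by apply: (cvgr_lt _ c); rewrite mulr0.
  by apply: filterS3 h1 (near_small_eps HF) h3 => l.
apply: (@cvg_L1_bounded _ _ (vertex_angles Z G r) _ _ K).
- exact: measurable_itv.
- by rewrite lebesgue_measure_itv/=; case: ifP => // _; rewrite -EFinB ltry.
- exact: finite_set_countable.
- have -> : `]0, 2 * pi[%classic = \bigcup_(i in [set: 'I_n])
      (`]0, 2 * pi[ `&` angular_arc th i).
    apply/seteqP; split => [t Dt|t [i _ []//]].
    by have [i it] := cover t (D2 t Dt); exists i.
  move=> mU B mB; rewrite setI_bigcupl.
  apply: fin_bigcup_measurable; first exact: finite_finset.
  move=> i _.
  have mi : measurable (`]0, 2 * pi[ `&` angular_arc th i).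
    by apply: measurableI; [exact: measurable_itv|exact: measurable_angular_arc].
  have : measurable_fun (`]0, 2 * pi[ `&` angular_arc th i) X; last exact.
  apply: (@eq_measurable_fun _ _ _ _ _ (limit_defect (e i))).
    by move=> t /set_mem[_ it]; rewrite (HX i t it).
  apply: (measurable_limit_defect (mg _ mi)) => //; last first.
    by move=> t [_ /act[]].
  by rewrite gt_eqF// (gen_pdist GZ (crofton_mark poly i)).
- apply: filterS near_good => l [l0 sl sR]; split.
    apply: measurable_funM; first exact: measurable_cst.
    apply: (eq_measurable_fun (fun t => radial (cell (2 * G) F (l ^- 2)) t - g t)).
      by move=> t _; rewrite (defectE Rstar0 GZ Gr HF).
    apply: measurable_funB; last by apply: mg; exact: measurable_itv.
    exact: (measurable_radial (star_cell HF sl) (measurable_itv _)).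
  move=> t _; rewrite (defectE Rstar0 GZ Gr HF)// normrM.
  have l2 : 0 < l ^+ 2 by rewrite exprn_gt0.
  rewrite (gtr0_norm l2); apply: (@le_trans _ _ (l ^+ 2 * (l ^- 2 * K))).
    by rewrite ler_pM2l// HK.
  by rewrite mulrA mulfV ?mul1r// gt_eqF.
- move=> t Dt nT.
  have [i it] := cover t (D2 t Dt).
  have sole : sole_active F G t (e i).
    apply: (sole_active_of HF (act _ _ it)) => vt; apply: nT; split => //.
    exact: D2.
  rewrite (HX i t it).
  apply: cvg_trans (defect_cvg HF sole); apply: near_eq_cvg.
  apply: filterS near_good => l [l0 sl sR].
  by rewrite (defectE Rstar0 GZ Gr HF).
Qed.

End DeterministicLimit.

(** * Genericity of Poisson configurations *)

Section Counting.
Context {R : realType} (T : choiceType).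
Implicit Types (A : set T).

Lemma counting_eq0 A : counting A = 0%:E :> \bar R -> A = set0.
Proof.
rewrite /counting; case: ifPn => // /asboolP finA [/eqP].
by rewrite pnatr_eq0 finmap.cardfs_eq0 => /eqP; exact: fset_set_set0.
Qed.

Lemma counting_fin A (k : nat) : counting A = k%:R%:E :> \bar R -> finite_set A.
Proof. by rewrite /counting; case: ifPn => // /asboolP. Qed.

Lemma counting_infty A : counting A = +oo%E :> \bar R -> A !=set0.
Proof.
rewrite /counting; case: ifPn => // /asboolPn infA _.
apply: contrapT => /set0P/negP; rewrite negbK => /eqP A0.
by apply: infA; rewrite A0; exact: finite_set0.
Qed.

Lemma counting_eq1 A x y : counting A = 1%:E :> \bar R -> A x -> A y -> x = y.
Proof.
rewrite /counting; case: ifPn => // /asboolP finA [/eqP].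
rewrite pnatr_eq1 => /finmap.cardfs1P[u Au] Ax Ay.
have A1 : A = [set u] by rewrite -(fset_setK finA) Au set_fset1.
by move: Ax Ay; rewrite A1 => -> ->.
Qed.

End Counting.

Section PoissonEvents.
Context d (Omega : measurableType d) d' (T : measurableType d') (R : realType).
Variables (P : probability Omega R) (m : set T -> \bar R) (Z : Omega -> set T).
Hypothesis PP : poisson_point_process P m Z.

Lemma ae_prob1 (E : set Omega) : measurable E -> P E = 1%E ->
  {ae P, forall w, E w}.
Proof.
move=> mE PE; exists (~` E); split; [exact: measurableC| |by []].
by rewrite probability_setC// PE subee.
Qed.

Lemma measurable_count_eq A (c : \bar R) : measurable A ->
  measurable [set w | point_count R Z A w = c].
Proof.
move=> mA; have := ppp_measurable PP mA measurableT (emeasurable_set1 c).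
by rewrite setTI.
Qed.

Lemma ae_empty A : measurable A -> m A = 0%E -> {ae P, forall w, Z w `&` A = set0}.
Proof.
move=> mA mA0.
have : {ae P, forall w, point_count R Z A w = 0%:R%:E}.
  apply: ae_prob1; first exact: measurable_count_eq.
  rewrite (ppp_law_fin PP) ?mA0//= /poisson_prob ltxx.
  by rewrite diracE mem_set.
by apply: filterS => w; exact: counting_eq0.
Qed.

Lemma ae_nonempty A : measurable A -> m A = +oo%E ->
  {ae P, forall w, Z w `&` A !=set0}.
Proof.
move=> mA mAoo.
have : {ae P, forall w, point_count R Z A w = +oo%E}.
  apply: ae_prob1; first exact: measurable_count_eq.
  exact: (ppp_law_infty PP).
by apply: filterS => w; exact: counting_infty.
Qed.

(** The Poisson probabilities of the finite counts add up to 1. *)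
Lemma ae_finite A : measurable A -> (m A < +oo)%E ->
  {ae P, forall w, finite_set (Z w `&` A)}.
Proof.
move=> mA mAoo; pose E (k : nat) := [set w | point_count R Z A w = k%:R%:E].
have mE k : measurable (E k) by exact: measurable_count_eq.
have : {ae P, forall w, (\bigcup_k E k) w}.
  apply: ae_prob1; first exact: bigcupT_measurable.
  rewrite measure_bigcup//; last first.
    apply/trivIsetP => i j _ _ ij; rewrite -subset0 => w [].
    by rewrite /E /= => -> [/eqP]; rewrite eqr_nat; exact/negP.
  transitivity (poisson_prob (fine (m A)) 0 [set: nat]); last exact: probability_setT.
  have nT : [set: nat] = \bigcup_k [set k] by apply/seteqP; split => k // _; exists k.
  rewrite [X in poisson_prob _ _ X]nT measure_bigcup//; last first.
    by apply/trivIsetP => i j _ _ ij; rewrite -subset0 => k [/= -> /eqP]; exact/negP.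
  by apply: eq_eseriesr => k _; exact: (ppp_law_fin PP).
by apply: filterS => w [k _]; exact: counting_fin.
Qed.

(** [1 - expR (- r) * (1 + r) <= r ^+ 2] follows from [1 - r <= expR (- r)]. *)
Lemma prob_two_points A : measurable A -> (0 < m A < +oo)%E ->
  (P (~` ([set w | point_count R Z A w = 0%:R%:E] `|`
          [set w | point_count R Z A w = 1%:R%:E])) <= ((fine (m A)) ^+ 2)%:E)%E.
Proof.
move=> mA /andP[mA0 mAoo].
rewrite probability_setC; last by apply: measurableU; exact: measurable_count_eq.
rewrite measureU; [|exact: measurable_count_eq|exact: measurable_count_eq|]; last first.
  by rewrite -subset0 => w [/= -> [/eqP]]; rewrite eqr_nat.
rewrite [X in (_ - (X + _))%E](ppp_law_fin PP 0 mA mAoo).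
rewrite [X in (_ - (_ + X))%E](ppp_law_fin PP 1 mA mAoo).
have r0 : 0 < fine (m A) by rewrite fine_gt0// mA0.
set r := fine _ in r0 *.
rewrite /poisson_prob r0 !esum_set1 ?lee_fin ?poisson_pmf_ge0//.
rewrite /poisson_pmf r0 expr0 expr1 fact0 factS fact0.
rewrite muln1 invr1 !mulr1 mul1r.
have := expR_ge1Dx (- r); have := expR_gt0 (- r); nra.
Qed.

End PoissonEvents.

Section MarkedLines.
Context {R : realType}.
Variables (mu : probability (measurableTypeR R) R) (Rstar : R).
Hypotheses (Rstar0 : 0 < Rstar) (mu_Rstar : mu `]Rstar, +oo[%classic = 1%E).

Notation leb := (@lebesgue_measure R).

Lemma intensity_rect (A B C : set (measurableTypeR R)) :
  measurable A -> measurable B -> measurable C ->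
  intensity mu (A `*` B `*` C) =
  (leb ((A : set R) `&` (`[0%R, +oo[%classic : set R)) *
   leb ((B : set R) `&` (`[0%R, (2 * pi)%R[%classic : set R)) *
   mu ((C : set R) `&` (`[0%R, +oo[%classic : set R)))%E.
Proof.
move=> mA mB mC; rewrite /intensity /mark_space -!setXI.
have mI (i : interval R) : measurable ([set` i] : set (measurableTypeR R)).
  exact: measurable_itv.
rewrite product_measure1E; first last.
- by apply: measurableI => //; exact: mI.
- by apply: measurableX; apply: measurableI => //; exact: mI.
by rewrite [X in (X * _)%E]product_measure1E//; apply: measurableI => //; exact: mI.
Qed.

Lemma mu_ge0_itv : mu `[0, +oo[%classic = 1%E.
Proof.
apply/eqP; rewrite eq_le probability_le1 ?measurable_itv//= -mu_Rstar.
rewrite le_measure ?inE; [by []|exact: measurable_itv|exact: measurable_itv|].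
by move=> x /=; rewrite !in_itv/= !andbT => /ltW; apply: le_trans; exact: ltW.
Qed.

Lemma mu_le_Rstar : mu `]-oo, Rstar]%classic = 0%E.
Proof.
have -> : `]-oo, Rstar]%classic = ~` `]Rstar, +oo[%classic :> set (measurableTypeR R).
  by rewrite setCitvr.
rewrite probability_setC; last exact: measurable_itv.
by rewrite mu_Rstar subee.
Qed.

End MarkedLines.

Section GenericAlmostSurely.
Context {R : realType} d (Omega : measurableType d) (P : probability Omega R).
Variables (mu : probability (measurableTypeR R) R) (Rstar : R).
Hypotheses (Rstar0 : 0 < Rstar) (mu_Rstar : mu `]Rstar, +oo[%classic = 1%E).
Variable Z : Omega -> set (mark R).
Hypothesis Z_mark : forall w, Z w `<=` mark_space.
Hypothesis PP : poisson_point_process P (intensity mu) Z.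

Let mI (i : interval R) : measurable ([set` i] : set (measurableTypeR R)).
Proof. exact: measurable_itv. Qed.

Definition slab (A B C : set R) : set (mark R) := A `*` B `*` C.

Lemma measurable_slab (A B C : interval R) :
  measurable (slab [set` A] [set` B] [set` C]
    : set (measurableTypeR R * measurableTypeR R * measurableTypeR R)).
Proof. by do 2 apply: measurableX => //. Qed.

Lemma ae_pdist_gt0 : {ae P, forall w, forall z, Z w z -> 0 < pdist z}.
Proof.
have : {ae P, forall w, Z w `&` slab `]-oo, 0] `]-oo, +oo[ `]-oo, +oo[ = set0}.
  apply: (ae_empty PP); first exact: measurable_slab.
  rewrite intensity_rect//.
  have -> : `]-oo, 0] `&` `[0, +oo[ = [set 0] :> set R.
    apply/seteqP; split => x /=; rewrite !in_itv/= ?andbT.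
      by move=> [x0 x0']; apply/eqP; rewrite eq_le x0.
    by move=> ->; rewrite lexx.
  by rewrite lebesgue_measure_set1 !mul0e.
apply: filterS => w Zw0 z Zz; rewrite ltNge; apply/negP => z0.
suff : set0 z by [].
by rewrite -Zw0; split.
Qed.

Lemma ae_pradius : {ae P, forall w, forall z, Z w z -> Rstar < pradius z}.
Proof.
have : {ae P, forall w, Z w `&` slab `]-oo, +oo[ `]-oo, +oo[ `]-oo, Rstar] = set0}.
  apply: (ae_empty PP); first exact: measurable_slab.
  rewrite intensity_rect//.
  suff -> : mu (`]-oo, Rstar] `&` `[0, +oo[) = 0%E by rewrite mule0.
  apply/eqP; rewrite eq_le measure_ge0 andbT -(mu_le_Rstar mu_Rstar).
  by rewrite le_measure ?inE//; exact: measurableI.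
apply: filterS => w Zw0 z Zz; rewrite ltNge; apply/negP => z0.
suff : set0 z by [].
by rewrite -Zw0; split.
Qed.

Lemma intensity_slab (x y y' : R) : 0 <= x -> 0 <= y -> y <= y' -> y' <= 2 * pi ->
  intensity mu (slab `[0, x[ `[y, y'[ `]-oo, +oo[) = (x * (y' - y))%:E.
Proof.
move=> x0 y0 yy' y'2; rewrite intensity_rect//.
have -> : `[0, x[ `&` `[0, +oo[ = `[0, x[%classic :> set R.
  by apply/setIidl => t /=; rewrite !in_itv/= andbT => /andP[].
have -> : `[y, y'[ `&` `[0, 2 * pi[ = `[y, y'[%classic :> set R.
  apply/setIidl => t /=; rewrite !in_itv/= => /andP[h1 h2].
  by rewrite (le_trans y0 h1) (lt_le_trans h2).
have -> : `]-oo, +oo[ `&` `[0, +oo[ = `[0, +oo[%classic :> set R.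
  by apply/setIidr.
rewrite (mu_ge0_itv Rstar0 mu_Rstar) mule1 !lebesgue_measure_itv/= !lte_fin.
have -> : (if 0 < x then (x%:E - 0%:E)%E else 0%E) = x%:E.
  case: ltgtP x0 => // [_ _|<- //].
  by rewrite sube0.
have -> : (if y < y' then (y'%:E - y%:E)%E else 0%E) = (y' - y)%:E.
  case: ltgtP yy' => // <- _; by rewrite subrr.
by rewrite EFinM.
Qed.

Lemma mark_angle w z : Z w z -> 0 <= pangle z < 2 * pi.
Proof.
by case: z => [[rho th] rr] /Z_mark[[_ /=]]; rewrite in_itv.
Qed.

Lemma mark_pdist_ge0 w z : Z w z -> 0 <= pdist z.
Proof.
by case: z => [[rho th] rr] /Z_mark[[/= + _] _]; rewrite in_itv/= andbT.
Qed.

Lemma ae_locally_finite : {ae P, forall w, forall M,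
  finite_set (Z w `&` [set z | pdist z < M])}.
Proof.
have : {ae P, forall w, forall n : nat,
    finite_set (Z w `&` slab `[0, n%:R[ `[0, 2 * pi[ `]-oo, +oo[)}.
  apply: ae_foralln => n; apply: (ae_finite PP); first exact: measurable_slab.
  by rewrite intensity_slab ?ltry// mulr_ge0// pi_ge0.
apply: filterS => w fin M.
have [n Mn] : exists n : nat, M <= n%:R.
  by exists (Num.truncn `|M|).+1; rewrite (le_trans (ler_norm M))// ltW// truncnS_gt.
apply: sub_finite_set (fin n) => z [Zz zM]; split => //.
split; last by rewrite /= in_itv.
split; rewrite /= in_itv/=; last exact: mark_angle Zz.
by rewrite (mark_pdist_ge0 Zz) (lt_le_trans zM).
Qed.

Lemma sector_ex (N : nat) (t : R) : 0 <= t < 2 * pi -> (0 < N)%N ->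
  exists2 j : nat, (j < N)%N & 2 * pi * j%:R / N%:R <= t < 2 * pi * j.+1%:R / N%:R.
Proof.
have pi0 := @pi_gt0 R; move=> /andP[t0 t2] N0.
have N0' : 0 < N%:R :> R by rewrite ltr0n.
have pp : 0 < 2 * pi :> R by rewrite mulr_gt0.
pose x := t * N%:R / (2 * pi).
have x0 : 0 <= x by rewrite divr_ge0 ?mulr_ge0// ltW.
have /andP[x1 x2] := truncn_itv x0.
exists (Num.truncn x).
  rewrite -(ltr_nat R); apply: (le_lt_trans x1).
  by rewrite /x ltr_pdivrMr// mulrC ltr_pM2l.
by move: x1 x2; rewrite /x ler_pdivlMr// ltr_pdivrMr// ler_pdivrMr// ltr_pdivlMr// ![_%:R * _]mulrC => -> ->.
Qed.

(** Two points at distance less than [n] with the same angle share one of the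
    [N] angular sectors of width [2 pi / N], each of which contains two points
    with probability of order [N ^- 2]; the union over sectors has probability
    of order [1 / N], for every [N]. *)
Lemma ae_angle_inj : {ae P, forall w, forall z z', Z w z -> Z w z' ->
  pangle z = pangle z' -> z = z'}.
Proof.
have pi0 := @pi_gt0 R.
pose A (n N j : nat) := slab `[0, n.+1%:R[
  `[2 * pi * j%:R / N%:R, 2 * pi * j.+1%:R / N%:R[ `]-oo, +oo[.
pose E n N j := ~` ([set w | point_count R Z (A n N j) w = 0%:R%:E] `|`
                    [set w | point_count R Z (A n N j) w = 1%:R%:E]).
have mE n N j : measurable (E n N j).
  apply: measurableC; apply: measurableU;
  by apply: (measurable_count_eq PP); exact: measurable_slab.
pose c n : R := (n.+1%:R * (2 * pi)) ^+ 2.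
have PE n N j : (j < N.+1)%N -> (P (E n N.+1 j) <= (c n / N.+1%:R ^+ 2)%:E)%E.
  move=> jN.
  have mAE : intensity mu (A n N.+1 j) = (n.+1%:R * (2 * pi / N.+1%:R))%:E.
    rewrite intensity_slab//.
    - by congr (_ * _)%:E; rewrite -mulrBl -mulrBr -natrB// subSnn mulr1.
    - by rewrite !mulr_ge0 ?invr_ge0// ltW.
    - by rewrite ler_pM2r ?invr_gt0// ler_pM2l ?mulr_gt0// ler_nat.
    - by rewrite ler_pdivrMr// ler_pM2l ?mulr_gt0// ler_nat.
  have := prob_two_points PP (A := A n N.+1 j).
  rewrite mAE /= lte_fin ltry andbT.
  have -> : (n.+1%:R * (2 * pi / N.+1%:R)) ^+ 2 = c n / N.+1%:R ^+ 2.
    by rewrite /c mulrA expr_div_n.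
  apply; first exact: measurable_slab.
  by rewrite mulr_gt0// divr_gt0// mulr_gt0.
pose B n N := \big[setU/set0]_(j < N.+1) E n N.+1 j.
have mB n N : measurable (B n N) by apply: bigsetU_measurable.
have PB n N : (P (B n N) <= (c n / N.+1%:R)%:E)%E.
  apply: (le_trans (Boole_inequality P _)); first by [].
  apply: (@le_trans _ _ (\sum_(j < N.+1) (c n / N.+1%:R ^+ 2)%:E)%E).
    by apply: lee_sum => j _; exact: PE.
  rewrite sumEFin lee_fin big_const card_ord iter_addr_0.
  have : N.+1%:R != 0 :> R by rewrite pnatr_eq0.
  move=> k0; by rewrite -[leLHS]mulr_natr expr2 invfM mulrA divfK.
have aeB n : {ae P, forall w, exists N, ~ B n N w}.
  exists (\bigcap_N B n N); split; first exact: bigcapT_measurable.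
    apply/eqP; rewrite eq_le measure_ge0 andbT; apply/lee_addgt0Pr => e e0.
    rewrite add0e.
    have [N Nc] : exists N : nat, c n / e < N%:R.
      by exists (Num.truncn (c n / e)).+1; rewrite truncnS_gt.
    apply: (@le_trans _ _ (P (B n N))).
      by rewrite le_measure ?inE//; [exact: bigcapT_measurable|move=> w; exact].
    apply: (le_trans (PB n N)); rewrite lee_fin ler_pdivrMr// mulrC.
    rewrite -ler_pdivrMr// (le_trans (ltW Nc))// ler_nat//.
  move=> w /= nB N _; apply: contrapT => nBN; apply: nB; by exists N.
have := ae_foralln aeB; apply: filterS => w nB z z' Zz Zz' zz'.
pose M := Num.max (pdist z) (pdist z').
have [zM z'M] : pdist z <= M /\ pdist z' <= M by rewrite /M !le_max !lexx orbT.
have [N nBN] := nB (Num.truncn `|M|).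
have Mn : M < (Num.truncn `|M|).+1%:R.
  by apply: (le_lt_trans (ler_norm M)); exact: truncnS_gt.
have [j jN jz] := sector_ex (mark_angle Zz) (ltn0Sn N).
have inA k : Z w k -> pdist k <= M -> pangle k = pangle z ->
    (Z w `&` A (Num.truncn `|M|) N.+1 j) k.
  move=> Zk kM kz; split => //; split; last by rewrite /= in_itv.
  split; rewrite /= in_itv/=; last by rewrite -/(pangle k) kz.
  by rewrite (mark_pdist_ge0 Zk) (le_lt_trans kM).
have Az := inA z Zz zM erefl; have Az' := inA z' Zz' z'M (esym zz').
apply: contrapT => nzz'; apply: nBN.
rewrite /B -bigcup_mkord; exists j => //= -[/counting_eq0|/counting_eq1].
  by move=> A0; rewrite A0 in Az.
by move=> /(_ z z' Az Az').
Qed.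

(** The part of the mark space over an open quadrant has infinite intensity. *)
Lemma ae_quadrant (s1 s2 : bool) : {ae P, forall w, exists2 z, Z w z &
  0 < (-1) ^+ s1 * cos (pangle z) /\ 0 < (-1) ^+ s2 * sin (pangle z)}.
Proof.
have pi0 := @pi_gt0 R.
have [y [y' [y0 yy' y'2 quad]]] : exists y y' : R, [/\ 0 <= y, y < y', y' <= 2 * pi &
    forall t, y < t < y' ->
      0 < (-1) ^+ s1 * cos t /\ 0 < (-1) ^+ s2 * sin t].
  have c1 t : 0 < t < pi / 2 -> 0 < cos t :> R by move=> h; apply: cos_gt0_pihalf; lra.
  have c2 t : 0 < t < pi / 2 -> 0 < sin t :> R by exact: sin_gt0_pihalf.
  case: s1; case: s2; rewrite ?expr1 ?expr0 ?mul1r.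
  - exists pi, (pi + pi / 2); split; [lra|lra|lra|move=> t tt].
    have tE : t = (t - pi) + pi by rewrite subrK.
    have tt' : 0 < t - pi < pi / 2 by lra.
    rewrite ?mulN1r ?mul1r tE cosDpi sinDpi !opprK; split; [exact: c1|exact: c2].
  - exists (pi / 2), pi; split; [lra|lra|lra|move=> t tt].
    have tE : t = (t - pi / 2) + pi / 2 by rewrite subrK.
    have tt' : 0 < t - pi / 2 < pi / 2 by lra.
    rewrite ?mulN1r ?mul1r tE cosDpihalf sinDpihalf !opprK; split; [exact: c2|exact: c1].
  - exists (pi + pi / 2), (2 * pi); split; [lra|lra|lra|move=> t tt].
    have tE : t = (t - pi - pi / 2) + pi / 2 + pi by ring.
    have tt' : 0 < t - pi - pi / 2 < pi / 2 by lra.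
    rewrite ?mulN1r ?mul1r tE cosDpi sinDpi cosDpihalf sinDpihalf !opprK.
    by split; [exact: c2|exact: c1].
  - exists 0, (pi / 2); split; [lra|lra|lra|move=> t tt].
    by rewrite !mul1r; split; [exact: c1|exact: c2].
have : {ae P, forall w, Z w `&` slab `[0, +oo[ `]y, y'[ `]-oo, +oo[ !=set0}.
  apply: (ae_nonempty PP); first exact: measurable_slab.
  rewrite intensity_rect//.
  have -> : `[0, +oo[ `&` `[0, +oo[ = `[0, +oo[%classic :> set R by rewrite setIid.
  have -> : `]y, y'[ `&` `[0, 2 * pi[ = `]y, y'[%classic :> set R.
    apply/setIidl => t /=; rewrite !in_itv/= => /andP[h1 h2].
    by rewrite (le_trans y0 (ltW h1)) (lt_le_trans h2).
  have -> : `]-oo, +oo[ `&` `[0, +oo[ = `[0, +oo[%classic :> set R by apply/setIidr.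
  rewrite (mu_ge0_itv Rstar0 mu_Rstar) mule1 !lebesgue_measure_itv/=.
  rewrite lte_fin yy' -EFinB ltry sube0.
  by rewrite gt0_mulye// lte_fin subr_gt0.
apply: filterS => w [z [Zz [[_ /= zy] _]]]; exists z => //.
by apply: quad; move: zy; rewrite in_itv.
Qed.

Lemma ae_generic_config : {ae P, forall w, generic_config Rstar (Z w)}.
Proof.
have h4 : {ae P, forall w, forall s1 s2 : bool, exists2 z, Z w z &
    0 < (-1) ^+ s1 * cos (pangle z) /\ 0 < (-1) ^+ s2 * sin (pangle z)}.
  apply: filter_forall => s1; apply: filter_forall => s2.
  exact: ae_quadrant.
have and_ae (A B : Omega -> Prop) : {ae P, forall w, A w} -> {ae P, forall w, B w} ->
    {ae P, forall w, A w /\ B w} by apply: filterS2 => w.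
have h := and_ae _ _ (and_ae _ _ ae_pdist_gt0 ae_pradius)
  (and_ae _ _ ae_locally_finite (and_ae _ _ ae_angle_inj h4)).
apply: filterS h => w [[w1 w2] [w3 [w4 w5]]].
by split => //; exact: Z_mark.
Qed.

End GenericAlmostSurely.

(** * Almost sure convergence of the defect *)

Theorem theorem5p3 (R : realType)
  (d : measure_display) (Omega : measurableType d) (P : probability Omega R)
  (mu : probability (measurableTypeR R) R) (Rstar : R)
  (mu_mean : (\int[mu]_r (r : R)%:E = 1)%E)
  (mu_moment2 : (\int[mu]_r ((r : R) ^+ 2)%:E < +oo)%E)
  (Rstar_gt0 : 0 < Rstar)
  (mu_Rstar : mu `]Rstar, +oo[%classic = 1%E)
  (Z : Omega -> set (mark R))
  (Z_mark : forall w, Z w `<=` mark_space)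
  (Z_poisson : poisson_point_process P (intensity mu) Z)
  (K0 : set (R * R)) (K0_compact : compact K0) :
  {ae P, forall w,
    exists (Ne : nat) (V : 'I_Ne -> R * R) (th : 'I_Ne -> R)
           (e : 'I_Ne -> mark R),
      crofton_polygon (Z w) V th e /\
      forall X : R -> R,
        (forall (i : 'I_Ne) (t : R),
           angular_arc th i t -> X t = limit_defect (e i) t) ->
        cvg_L1 `]0, 2 * pi[
          (fun lam t => lam ^+ 2 * defect K0 (Z w) lam t) X}.
Proof.
apply: filterS (ae_generic_config Rstar_gt0 mu_Rstar Z_mark Z_poisson) => w GZ.
exact: (config_cvg_L1 Rstar_gt0 GZ K0).
Qed.
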